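(* Let $K$ be a field, $R=K[\![x,y,z]\!]$, let $u,v,w\ge 0$ be integers, and let $$h=\bigl(1,3,3,\underbrace{3,\ldots,3}_{u},\underbrace{2,\ldots,2}_{v},\underbrace{1,\ldots,1}_{w},1\bigr)$$ be an O-sequence. Then there exists a complete intersection $A=R/(f,g,p)$ with Hilbert function $h$. More precisely: (1) Suppose $u=v=w=0$. Then $\mathrm{Ann}_R(XYZ)=(x^2,y^2,z^2)$ is a complete intersection and $R/\mathrm{Ann}_R(XYZ)$ has Hilbert function $h=(1,3,3,1)$. (2) Suppose at least one of $u,v,w$ is nonzero, and let $F=X^{u+v+w+3}+Y^{u+v+3}+Z^{u+3}+XYZ$. Then $$\mathrm{Ann}_R(F)=\bigl(yz-x^{u+v+w+2},\ xz-y^{u+v+2},\ xy-z^{u+2}\bigr)$$ is a complete intersection and $R/\mathrm{Ann}_R(F)$ has Hilbert function $h$.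
   Context: The Hilbert function of an Artinian local ring $(A,\mathfrak m)$ with residue field $K$ is $\mathrm{HF}_A(t)=\dim_K \mathfrak m^t/\mathfrak m^{t+1}$, written as a vector. An O-sequence is a sequence satisfying Macaulay's bound, i.e. a Hilbert function of a standard graded $K$-algebra. Let $\mathcal D=K_{DP}[X,Y,Z]$ be the $K$-vector space of polynomials in $X,Y,Z$, viewed as an $R$-module via the contraction action: $x^{a}y^{b}z^{c}\circ X^{a'}Y^{b'}Z^{c'}=X^{a'-a}Y^{b'-b}Z^{c'-c}$ if $a'\ge a$, $b'\ge b$, $c'\ge c$, and $0$ otherwise, extended $K$-linearly. For $F\in\mathcal D$, $\mathrm{Ann}_R(F)=\{f\in R: f\circ F=0\}$. An ideal $I\subseteq R$ is called a complete intersection if $R/I$ is an Artinian complete intersection. *)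

(* Defs.v *)
From HB Require Import structures.
From mathcomp Require Import all_boot all_order all_algebra.
From mathcomp Require Import generic_quotient ring_quotient.
From mathcomp Require Import boolp classical_sets.
From mathcomp Require Import mpoly.

Set Implicit Arguments.
Unset Strict Implicit.
Unset Printing Implicit Defensive.

Import GRing.Theory.

Local Open Scope ring_scope.
Local Open Scope classical_set_scope.

(* Formal power series over K in n commuting variables, given by their        *)
(* coefficients on the monomials 'X_{1..n}.                                   *)
Record mpseries (n : nat) (K : Type) := MPSeries {
  mpscoef :> 'X_{1..n} -> K
}.

Section PowerSeries.

Variables (n : nat) (K : comNzRingType).

Local Notation R := (mpseries n K).

Implicit Types (f g h : R) (m : 'X_{1..n}).

HB.instance Definition _ := gen_eqMixin R.
HB.instance Definition _ := gen_choiceMixin R.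

Lemma mpseriesP f g : (forall m, f m = g m) -> f = g.
Proof. by case: f g => [f] [g] /= /funext->. Qed.

Definition mps0 : R := MPSeries (fun=> 0).
Definition mps1 : R := MPSeries (fun m => (m == 0%MM)%:R).
Definition mpsopp f : R := MPSeries (fun m => - f m).
Definition mpsadd f g : R := MPSeries (fun m => f m + g m).
Definition mpsscale (c : K) f : R := MPSeries (fun m => c * f m).

(* The bound on the degree of k is implied by k <= m: it only makes the index *)
(* set a finite type.                                                         *)
Definition mpsmul f g : R :=
  MPSeries (fun m =>
    \sum_(k : 'X_{1..n < (mdeg m).+1} | (k <= m)%MM) f k * g (m - k)%MM).

Definition mpsX (i : 'I_n) : R := MPSeries (fun m => (m == U_(i)%MM)%:R).

(* The ring laws below are inherited from {mpoly K[n]} by truncation.         *)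
Definition mpstrunc (d : nat) f : {mpoly K[n]} :=
  \sum_(k : 'X_{1..n < d}) f k *: 'X_[k].

Lemma mcoeff_mpstrunc d f m :
  (mpstrunc d f)@_m = if (mdeg m < d)%N then f m else 0.
Proof.
rewrite raddf_sum /=; case: ifPn => [md|md].
  rewrite (bigD1 (BMultinom md)) //= mcoeffZ mcoeffX eqxx mulr1 big1 ?addr0 //.
  move=> k; rewrite -val_eqE /= => /negbTE km.
  by rewrite mcoeffZ mcoeffX km mulr0.
rewrite big1 // => k _; rewrite mcoeffZ mcoeffX.
case: eqP => [km|_]; last by rewrite mulr0.
by case/negP: md; rewrite -km bmdeg.
Qed.

Lemma mpstruncP f g : (forall d, mpstrunc d f = mpstrunc d g) -> f = g.
Proof.
move=> fg; apply: mpseriesP => m.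
by have /mpolyP/(_ m) := fg (mdeg m).+1; rewrite !mcoeff_mpstrunc ltnSn.
Qed.

Lemma mpsmulE f g m (p q : {mpoly K[n]}) :
    (forall k, (mdeg k <= mdeg m)%N -> p@_k = f k) ->
    (forall k, (mdeg k <= mdeg m)%N -> q@_k = g k) ->
  mpsmul f g m = (p * q)@_m.
Proof.
move=> pf qg; rewrite (mcoeff_poly_mul_lin p q (ltnSn (mdeg m))) /=.
apply: eq_bigr => k km; rewrite pf ?qg //; first exact: mdegB.
by rewrite -ltnS bmdeg.
Qed.

Lemma mpsmul_trunc f g m d : (mdeg m < d)%N ->
  mpsmul f g m = (mpstrunc d f * mpstrunc d g)@_m.
Proof.
move=> md; apply: mpsmulE => k km;
  by rewrite mcoeff_mpstrunc (leq_ltn_trans km md).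
Qed.

Lemma mpsaddA : associative mpsadd.
Proof. by move=> f g h; apply: mpseriesP => m /=; rewrite addrA. Qed.

Lemma mpsaddC : commutative mpsadd.
Proof. by move=> f g; apply: mpseriesP => m /=; rewrite addrC. Qed.

Lemma mpsadd0 : left_id mps0 mpsadd.
Proof. by move=> f; apply: mpseriesP => m /=; rewrite add0r. Qed.

Lemma mpsaddN : left_inverse mps0 mpsopp mpsadd.
Proof. by move=> f; apply: mpseriesP => m /=; rewrite addNr. Qed.

HB.instance Definition _ :=
  GRing.isZmodule.Build R mpsaddA mpsaddC mpsadd0 mpsaddN.

Lemma mpsmulA : associative mpsmul.
Proof.
move=> f g h; apply: mpseriesP => m; pose T := mpstrunc (mdeg m).+1.
rewrite (@mpsmulE _ _ m (T f) (T g * T h)).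
- rewrite (@mpsmulE _ _ m (T f * T g) (T h)) ?mulrA // => k km.
    by rewrite -(mpsmul_trunc f g).
  by rewrite mcoeff_mpstrunc ltnS km.
- by move=> k km; rewrite mcoeff_mpstrunc ltnS km.
- by move=> k km; rewrite -(mpsmul_trunc g h).
Qed.

Lemma mpsmulC : commutative mpsmul.
Proof.
by move=> f g; apply: mpseriesP => m; rewrite !(mpsmul_trunc _ _ (ltnSn _)) mulrC.
Qed.

Lemma mps1mul : left_id mps1 mpsmul.
Proof.
move=> f; apply: mpseriesP => m; pose T := mpstrunc (mdeg m).+1.
rewrite (@mpsmulE _ _ m 1 (T f)) ?mul1r.
- by rewrite mcoeff_mpstrunc ltnSn.
- by move=> k _; rewrite mcoeff1.
- by move=> k km; rewrite mcoeff_mpstrunc ltnS km.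
Qed.

Lemma mpsmulDl : left_distributive mpsmul mpsadd.
Proof.
move=> f g h; apply: mpseriesP => m /=; rewrite -big_split /=.
by apply: eq_bigr => k _; rewrite mulrDl.
Qed.

Lemma mps1_neq0 : mps1 != 0.
Proof.
apply/eqP => /(congr1 (fun f : R => f 0%MM)) /= /eqP.
by rewrite eqxx oner_eq0.
Qed.

HB.instance Definition _ := GRing.Zmodule_isComNzRing.Build R
  mpsmulA mpsmulC mps1mul mpsmulDl mps1_neq0.

Lemma mpsscaleA (a b : K) f : mpsscale a (mpsscale b f) = mpsscale (a * b) f.
Proof. by apply: mpseriesP => m /=; rewrite mulrA. Qed.

Lemma mpsscale1 : left_id 1 mpsscale.
Proof. by move=> f; apply: mpseriesP => m /=; rewrite mul1r. Qed.

Lemma mpsscaleDr : right_distributive mpsscale +%R.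
Proof. by move=> a f g; apply: mpseriesP => m /=; rewrite mulrDr. Qed.

Lemma mpsscaleDl f : {morph mpsscale^~ f : a b / a + b}.
Proof. by move=> a b; apply: mpseriesP => m /=; rewrite mulrDl. Qed.

HB.instance Definition _ := GRing.Zmodule_isLmodule.Build K R
  mpsscaleA mpsscale1 mpsscaleDr mpsscaleDl.

Lemma mpsscaleAl (a : K) f g : a *: (f * g) = (a *: f) * g.
Proof.
apply: mpseriesP => m /=; rewrite mulr_sumr.
by apply: eq_bigr => k _; rewrite mulrA.
Qed.

HB.instance Definition _ := GRing.Lmodule_isLalgebra.Build K R mpsscaleAl.
HB.instance Definition _ := GRing.Lalgebra_isComAlgebra.Build K R.

(* The contraction action of power series on divided power polynomials; the   *)
(* monomials of f that do not divide 'X_[j] kill it, so that the inner sum is *)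
(* finite.                                                                    *)
Definition contract f (F : {mpoly K[n]}) : {mpoly K[n]} :=
  \sum_(j <- msupp F) \sum_(k : 'X_{1..n < (mdeg j).+1} | (k <= j)%MM)
    (f k * F@_j) *: 'X_[j - k].

Definition Ann (F : {mpoly K[n]}) : set R := [set f | contract f F = 0].

End PowerSeries.

Section QuotientAlgebra.

Variables (K : comNzRingType) (R : comAlgType K) (I : idealr R).

Local Notation Q := {ideal_quot I}.

Definition quot_scale (c : K) (a : Q) : Q := \pi_Q%qT (c%:A) * a.

Lemma quot_scaleA (a b : K) (v : Q) :
  quot_scale a (quot_scale b v) = quot_scale (a * b) v.
Proof. by rewrite /quot_scale mulrA -rmorphM -scalerAl mul1r scalerA. Qed.

Lemma quot_scale1 : left_id 1 quot_scale.
Proof. by move=> v; rewrite /quot_scale scale1r rmorph1 mul1r. Qed.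

Lemma quot_scaleDr : right_distributive quot_scale +%R.
Proof. by move=> a u v; rewrite /quot_scale mulrDr. Qed.

Lemma quot_scaleDl (v : Q) : {morph quot_scale^~ v : a b / a + b}.
Proof. by move=> a b; rewrite /quot_scale scalerDl rmorphD mulrDl. Qed.

HB.instance Definition _ := GRing.Zmodule_isLmodule.Build K Q
  quot_scaleA quot_scale1 quot_scaleDr quot_scaleDl.

Lemma quot_scaleAl (a : K) (u v : Q) : a *: (u * v) = (a *: u) * v.
Proof. exact: mulrA. Qed.

HB.instance Definition _ := GRing.Lmodule_isLalgebra.Build K Q quot_scaleAl.
HB.instance Definition _ := GRing.Lalgebra_isComAlgebra.Build K Q.

End QuotientAlgebra.

Section Ideals.

Variable A : comNzRingType.

(* Unlike idealr, this does not exclude the unit ideal.                       *)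
Definition is_ideal (J : set A) : Prop :=
  [/\ J 0, forall a b, J a -> J b -> J (a + b) & forall r a, J a -> J (r * a)].

Definition ideal_span (s : seq A) : set A := smallest is_ideal [set` s].

Fixpoint ideal_pow (J : set A) (t : nat) : set A :=
  if t is t'.+1 then
    smallest is_ideal [set a * b | a in ideal_pow J t' & b in J]
  else [set: A].

Definition maximal_ideal (M : set A) : Prop :=
  [/\ is_ideal M, ~ M 1 &
      forall J, is_ideal J -> ~ J 1 -> M `<=` J -> J = M].

Definition local_ring (M : set A) : Prop :=
  maximal_ideal M /\ forall M', maximal_ideal M' -> M' = M.

Definition artinian : Prop :=
  forall J : nat -> set A, (forall i, is_ideal (J i)) ->
    (forall i, J i.+1 `<=` J i) ->
  exists N, forall i, (N <= i)%N -> J i = J N.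

Definition regular_sequence (s : seq A) : Prop :=
  ~ ideal_span s 1 /\
  forall i, (i < size s)%N -> forall a,
    ideal_span (take i s) (s`_i * a) -> ideal_span (take i s) a.

End Ideals.

(* For R a regular local ring, such as K[[x,y,z]].                            *)
Definition complete_intersection (R : comNzRingType) (J : set R) : Prop :=
  exists I : idealr R,
    [/\ [set` I] = J, artinian {ideal_quot I} &
        exists s : seq R, regular_sequence s /\ J = ideal_span s].

(* dim_K V/W = d for subspaces W of V: V/W has a basis with d elements.       *)
Definition quot_dim (K : fieldType) (E : lmodType K) (V W : set E) (d : nat) :
    Prop :=
  exists b : 'I_d -> E,
    (forall i, V (b i)) /\
    (forall v, V v -> exists! c : {ffun 'I_d -> K},
      W (v - \sum_(i < d) c i *: b i)).

Definition hilbert_function (K : fieldType) (A : comAlgType K)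
    (h : nat -> nat) : Prop :=
  exists M : set A, local_ring M /\
    forall t, quot_dim (ideal_pow M t) (ideal_pow M t.+1) (h t).

Definition quotient_hilbert_function (K : fieldType) (R : comAlgType K)
    (J : set R) (h : nat -> nat) : Prop :=
  exists I : idealr R, [set` I] = J /\ hilbert_function {ideal_quot I} h.

(* The Macaulay bound a^<t>: if a = 'C(k_t, t) + 'C(k_(t-1), t-1) + ... is    *)
(* the t-th Macaulay expansion, computed greedily, then                       *)
(* a^<t> = 'C(k_t + 1, t + 1) + 'C(k_(t-1) + 1, t) + ...                      *)
(* The largest k with 'C(k, t) <= a is at most a + t - 1 when t > 0.          *)
Fixpoint macaulay (t a : nat) : nat :=
  if t is t'.+1 then
    if a == 0%N then 0%N else
    let k := (\max_(k < a + t | 'C(k, t) <= a) k)%N in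
    ('C(k.+1, t.+1) + macaulay t' (a - 'C(k, t)))%N
  else 0%N.

Definition O_sequence (h : nat -> nat) : Prop :=
  h 0%N = 1%N /\ forall t, (0 < t)%N -> (h t.+1 <= macaulay t (h t))%N.

(* A finite sequence is read as a function on nat that vanishes past its end. *)
Definition hvec (s : seq nat) : nat -> nat := fun t => nth 0%N s t.

Definition hseq (u v w : nat) : seq nat :=
  [:: 1; 3; 3]%N ++ nseq u 3%N ++ nseq v 2%N ++ nseq w 1%N ++ [:: 1%N].

(* Main.v *)
From HB Require Import structures.
Require Import Defs.
From mathcomp Require Import all_boot all_order all_algebra.
From mathcomp Require Import generic_quotient ring_quotient.
From mathcomp Require Import boolp classical_sets.
From mathcomp Require Import ssrcomplements mpoly.
From mathcomp Require Import ring zify.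

(** Write a = u + v + w + 2, b = u + v + 2, c = u + 2 and, when (u, v, w) is
    nonzero (so that a >= 3), let J be the ideal of R = K[[x, y, z]] generated
    by f = yz - x^a, g = xz - y^b and p = xy - z^c.

    The relations modulo J.  Substituting p, f and g in turn gives
      x y^2 = y z^c = x^a z^(c-1) = x^(a-1) y^b z^(c-2) = x y^2 w,
    where w = x^(a-2) y^(b-2) z^(c-2).  As a >= 3, the series 1 - w is a unit,
    so x y^2 lies in J, and by symmetry so does every product of a power of one
    variable by the square of another one ([cusp_mixed]).  For a = b = c = 2,
    w would be 1: this is why u = v = w = 0 needs another ideal.  Consequently
    the t-th power of the maximal ideal of A = R/J is generated by x^t, y^t and
    z^t.  Also x^(a+1) = y^(b+1) = z^(c+1) = xyz in A, an element killed by the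
    three variables; hence y^t is redundant when t > b, as is z^t when t > c,
    and x^t vanishes when t > a + 1.  Counting the remaining powers gives h.

    Duality.  Let [pairing F r] be the sum of the products of the coefficients
    of r and F; then r is in Ann F exactly when all multiples of r pair to zero
    with F ([AnnP]), and J is contained in Ann F by inspection of coefficients.
    The elements x^(a+1-t), y^(b+1-t), z^(c+1-t) are dual to x^t, y^t, z^t for
    this pairing and annihilate the next step of the filtration.  This shows
    both that the surviving powers are independent and, step by step, that an
    element of A orthogonal to everything is zero, which is Ann F = J.  The
    argument uses only a filtration by finite families with a dual family
    ([filt_quot_dim], [filt_nondegenerate], [Ann_dual_generator]), and it
    applies to XYZ as well, with the squarefree monomials as the filtration.

    Regularity of (f, g, p).  On the curve f = g = 0 the series
    rho = z^2 - x^(a-1) y^(b-1) vanishes outside the branch x = y = 0, because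
    x rho = z g + y^(b-1) f and y rho = z f + x^(a-1) g.  If p r is in (f, g),
    then restriction to that branch, where p = -z^c, puts r in (x, y); from
    p = xy (1 - w) - z^(c-2) rho it follows that xy (1 - w) r is in (f, g), and
    cancelling the unit, then y, then x ([curve_cancel_y]) puts r in (f, g).
    If g r is in (f), the same relations write r as a multiple of f plus x r'
    with g r' again in (f); iterating, r is in (f) by completeness
    ([adic_descent]). *)

Set Implicit Arguments.
Unset Strict Implicit.
Unset Printing Implicit Defensive.

Import GRing.Theory.

Local Open Scope ring_scope.
Local Open Scope classical_set_scope.

(** * Ideals generated by finite families *)

Section Ideals.

Variable A : comNzRingType.
Implicit Types (J : set A) (s : seq A) (a b c g : A).

Lemma is_ideal_smallest (G : set A) : is_ideal (smallest (@is_ideal _) G).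
Proof.
split=> [J [[]]//|a b Ja Jb J JG|r a Ja J JG].
  by have [_ + _] := JG.1; apply; [apply: Ja|apply: Jb].
by have [_ _] := JG.1; apply; apply: Ja.
Qed.

Lemma is_ideal_span s : is_ideal (ideal_span s).
Proof. exact: is_ideal_smallest. Qed.

Lemma ideal_span_mem s a : a \in s -> ideal_span s a.
Proof. by move=> as_; apply: sub_gen_smallest. Qed.

Lemma ideal_span_le J s : is_ideal J -> (forall a, a \in s -> J a) ->
  ideal_span s `<=` J.
Proof. by move=> idJ sJ; apply: smallest_sub. Qed.

Lemma idealB J a b : is_ideal J -> J a -> J b -> J (a - b).
Proof. by case=> _ JD JM Ja Jb; apply: JD => //; rewrite -mulN1r; apply: JM. Qed.

Lemma ideal_span_nil a : ideal_span [::] a <-> a = 0.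
Proof.
split=> [|->]; last by case: (is_ideal_span [::]).
apply: (@ideal_span_le [set 0]) => //; split=> //= [b c -> ->|c b ->].
  by rewrite addr0.
by rewrite mulr0.
Qed.

Lemma ideal_span_cons g s a :
  ideal_span (g :: s) a <-> exists c, ideal_span s (a - c * g).
Proof.
have [s0 sD sM] := is_ideal_span s; split; last first.
  have [_ gD gM] := is_ideal_span (g :: s).
  move=> [c sa]; rewrite -(subrK (c * g) a); apply: gD; last first.
    by apply: gM; apply: ideal_span_mem; rewrite mem_head.
  apply: ideal_span_le sa => [|b bs]; first exact: is_ideal_span.
  by apply: ideal_span_mem; rewrite in_cons bs orbT.
apply: (@ideal_span_le [set a | exists c, ideal_span s (a - c * g)]).
  split=> /= [|b b' [c sb] [c' sb']|r b [c sb]].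
  - by exists 0; rewrite mul0r subr0.
  - exists (c + c'); have -> : b + b' - (c + c') * g = (b - c * g) + (b' - c' * g).
      by ring.
    exact: sD.
  - exists (r * c); have -> : r * b - r * c * g = r * (b - c * g) by ring.
    exact: sM.
move=> b; rewrite in_cons => /orP[/eqP->|bs] /=.
  by exists 1; rewrite mul1r subrr.
by exists 0; rewrite mul0r subr0; apply: ideal_span_mem.
Qed.

Lemma ideal_span1 g a : ideal_span [:: g] a <-> exists c, a = c * g.
Proof.
rewrite ideal_span_cons; split=> -[c]; last by move=> ->; exists c; rewrite ideal_span_nil subrr.
by move/ideal_span_nil/eqP; rewrite subr_eq0 => /eqP ->; exists c.
Qed.

Lemma ideal_span2 f g a :
  ideal_span [:: f; g] a <-> exists c d, a = c * f + d * g.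
Proof.
rewrite ideal_span_cons; split=> -[c].
  by move=> /ideal_span1[d /eqP]; rewrite subr_eq addrC => /eqP ->; exists c, d.
by move=> [d ->]; exists c; rewrite ideal_span1; exists d; rewrite addrC addKr.
Qed.

End Ideals.

(** * Descending chains of subspaces *)

Section DescendingChains.

Variables (K : fieldType) (E : lmodType K).

Fixpoint lin_span (s : seq E) : set E :=
  if s is e :: s' then [set v | exists c : K, lin_span s' (v - c *: e)]
  else [set 0].

Lemma lin_span_cat (s r : seq E) (c : nat -> K) (v : E) :
  lin_span r (v - \sum_(i < size s) c i *: s`_i) -> lin_span (s ++ r) v.
Proof.
elim: s c v => [|e s IHs] c v /=; first by rewrite big_ord0 subr0.
rewrite big_ord_recl /= => H; exists (c 0%N); apply: (IHs (c \o succn)) => /=.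
by rewrite -addrA -opprD.
Qed.

Lemma lin_span_closed (s : seq E) :
  lin_span s 0 /\
  forall (c : K) a b, lin_span s a -> lin_span s b -> lin_span s (c *: a + b).
Proof.
elim: s => [|e s [IH0 IHD]] /=.
  by split=> // c a b -> ->; rewrite scaler0 addr0.
split=> [|c a b [ka sa] [kb sb]]; first by exists 0; rewrite scale0r subr0.
exists (c * ka + kb); suff -> : c *: a + b - (c * ka + kb) *: e =
  c *: (a - ka *: e) + (b - kb *: e) by exact: IHD.
by rewrite scalerDl -scalerA scalerBr addrACA opprD.
Qed.

(** Induction on s: the chain of the intersections with the span of the tail
    stabilizes, and the members of S are either eventually inside that span or
    always contain some vector with a nonzero component along the head, which
    reduces any element of S N to the intersection. *)
Lemma lin_span_dcc (s : seq E) (S : nat -> set E) :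
    (forall i, S i 0) ->
    (forall i (c : K) a b, S i a -> S i b -> S i (c *: a + b)) ->
    (forall i, S i.+1 `<=` S i) -> S 0%N `<=` lin_span s ->
  exists N, forall i, (N <= i)%N -> S i = S N.
Proof.
have Sle (T : nat -> set E) : (forall i, T i.+1 `<=` T i) ->
    forall i j, (i <= j)%N -> T j `<=` T i.
  move=> Tdec i j /subnK <-; elim: (j - i)%N => // k IHk.
  exact: subset_trans (Tdec _) IHk.
elim: s S => [|e s IHs] S S0 SD /[dup] /Sle {}Sle Sdec Ss.
  exists 0%N => i _; apply/seteqP; split; first exact: Sle.
  by move=> v /Ss /= ->.
have [s0 sD] := lin_span_closed s.
have [||||N SN] := IHs (fun i => S i `&` lin_span s).
- by move=> i; split.
- by move=> i c a b [Sa sa] [Sb sb]; split; [apply: SD|apply: sD].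
- by move=> i v [Sv sv]; split=> //; apply: Sdec.
- by move=> v [].
have SNs i v : (N <= i)%N -> S N v -> lin_span s v -> S i v.
  by move=> Ni Sv sv; have /seteqP[_ /(_ v)[//|]] := SN i Ni.
have [[n Sn]|/forallNP Sn] := pselect (exists n, S n `<=` lin_span s).
  exists (maxn n N) => i; rewrite geq_max => /andP[ni Ni].
  apply/seteqP; split; first by apply: Sle; rewrite geq_max ni.
  move=> v Sv; apply: SNs => //; first by apply: Sle Sv; apply: leq_maxr.
  by apply: Sn; apply: Sle Sv; apply: leq_maxl.
exists N => i Ni; apply/seteqP; split; first exact: Sle.
move=> v Sv; have [c sv] := Ss _ (Sle _ _ (leq0n N) _ Sv).
have [w Sw nsw] : exists2 w, S i w & ~ lin_span s w.
  by apply: contrapT => nw; apply: (Sn i) => w Sw; apply: contrapT => ?; case: nw; exists w.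
have [k sw] := Ss _ (Sle _ _ (leq0n i) _ Sw).
have k0 : k != 0 by apply/eqP => k0; case: nsw; rewrite k0 scale0r subr0 in sw.
suff Svw : S i (- (c / k) *: w + v).
  rewrite (_ : v = (c / k) *: w + (- (c / k) *: w + v)); first exact: SD.
  by rewrite addrA -scalerDl addrN scale0r add0r.
apply: (SNs) => //; first by apply: SD => //; apply: Sle Sw.
rewrite (_ : _ + v = - (c / k) *: (w - k *: e) + (v - c *: e)); first exact: sD.
rewrite scalerBr scalerA mulNr divfK // !scaleNr opprK.
by rewrite -addrA [c *: e + _]addrC subrK.
Qed.

End DescendingChains.

(** * Filtrations with a dual family *)

(** The ideal generated by e t will be the t-th power of the maximal ideal
    generated by xs, and d t is a family dual to e t for the functional ell
    which moreover annihilates e t.+1.  Duality does all the work: it gives the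
    independence of e t modulo the next step, hence the Hilbert function, and
    the nondegeneracy of ell. *)
Section DualFiltration.

Variables (K : fieldType) (A : comAlgType K) (ell : A -> K).
Variables (xs : seq A) (e d : nat -> seq A) (N : nat).

Local Notation M := (ideal_span xs).

Hypothesis ell_linear : forall (c : K) a b, ell (c *: a + b) = c * ell a + ell b.
Hypothesis residue : forall a, exists c : K, M (a - c%:A).
Hypothesis filt0 : e 0%N = [:: 1].
Hypothesis filt_prod : forall t a, a \in e t.+1 ->
  exists2 b, b \in e t & exists2 x, x \in xs & a = b * x.
Hypothesis filt_mul : forall t a x, a \in e t -> x \in xs ->
  ideal_span (e t.+1) (a * x).
Hypothesis filt_end : e N = [::].
Hypothesis dual_pairing : forall t i j, (i < size (e t))%N -> (j < size (e t))%N ->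
  ell ((d t)`_i * (e t)`_j) = (i == j)%:R.
Hypothesis dual_orth : forall t i b, (i < size (e t))%N -> b \in e t.+1 ->
  (d t)`_i * b = 0.

Lemma ellD a b : ell (a + b) = ell a + ell b.
Proof. by rewrite -[a]scale1r ell_linear mul1r scale1r. Qed.

Lemma ell0 : ell 0 = 0.
Proof. by have /eqP := ellD 0 0; rewrite addr0 -subr_eq0 opprD addNKr oppr_eq0 => /eqP. Qed.

Lemma ellZ c a : ell (c *: a) = c * ell a.
Proof. by rewrite -[c *: a]addr0 ell_linear ell0 addr0. Qed.

Lemma ell_sum n (F : 'I_n -> A) : ell (\sum_(i < n) F i) = \sum_(i < n) ell (F i).
Proof. by apply: (big_morph ell); [exact: ellD|exact: ell0]. Qed.

Lemma filt_mulM t a x : ideal_span (e t) a -> M x -> ideal_span (e t.+1) (a * x).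
Proof.
have [V0 VD VM] := is_ideal_span (e t.+1).
move=> Va; move: x; apply: (@ideal_span_le _ [set x | ideal_span (e t.+1) (a * x)]).
  split=> /= [|y z Vy Vz|r y Vy]; first by rewrite mulr0.
    by rewrite mulrDr; apply: VD.
  by rewrite mulrCA; apply: VM.
move=> x xxs /=; move: a Va.
apply: (@ideal_span_le _ [set a | ideal_span (e t.+1) (a * x)]).
  split=> /= [|y z Vy Vz|r y Vy]; first by rewrite mul0r.
    by rewrite mulrDl; apply: VD.
  by rewrite -mulrA; apply: VM.
by move=> a ea /=; apply: filt_mul.
Qed.

Lemma ideal_powE t : ideal_pow M t = ideal_span (e t).
Proof.
elim: t => [|t IHt] /=.
  apply/seteqP; split=> // a _; rewrite filt0 -[a]mulr1.
  have [_ _ VM] := is_ideal_span [:: 1 : A].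
  by apply: VM; apply: ideal_span_mem; rewrite mem_head.
apply/seteqP; split.
  apply: smallest_sub; first exact: is_ideal_span.
  by rewrite IHt => _ [a Va [b Mb <-]]; apply: filt_mulM.
apply: ideal_span_le => [|a /filt_prod[b eb [x xxs ->]]].
  exact: is_ideal_smallest.
apply: sub_gen_smallest; exists b; first by rewrite IHt; apply: ideal_span_mem.
by exists x => //; apply: ideal_span_mem.
Qed.

(** The coefficients of a combination of e t only matter modulo the maximal
    ideal, hence can be taken in K. *)
Lemma filt_expand t v : ideal_span (e t) v ->
  exists c : nat -> K, ideal_span (e t.+1) (v - \sum_(i < size (e t)) c i *: (e t)`_i).
Proof.
have [V0 VD VM] := is_ideal_span (e t.+1).
suff: forall s, {subset s <= e t} -> ideal_span s v ->
    exists c : nat -> K, ideal_span (e t.+1) (v - \sum_(i < size s) c i *: s`_i).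
  by apply.
move=> s; elim: s v => [|a s IHs] v sub.
  by move/ideal_span_nil->; exists (fun=> 0); rewrite big_ord0 subr0.
move/ideal_span_cons=> [r /IHs[b bs|c Vc]].
  by apply: sub; rewrite in_cons bs orbT.
have [k Mk] := residue r.
exists (fun i => if i is j.+1 then c j else k); rewrite /= big_ord_recl /=.
rewrite (_ : v - _ = (v - r * a - \sum_(i < size s) c i *: s`_i) + a * (r - k%:A)).
  apply: VD => //; apply: filt_mulM => //.
  by apply: ideal_span_mem; apply: sub; rewrite mem_head.
rewrite -[k *: a]mulr1 -scalerAl scalerAr; ring.
Qed.

Lemma dual_orth_span t i w : (i < size (e t))%N -> ideal_span (e t.+1) w ->
  (d t)`_i * w = 0.
Proof.
move=> it; move: w; apply: (@ideal_span_le _ [set w | (d t)`_i * w = 0]).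
  split=> /= [|a b da db|r a da]; first by rewrite mulr0.
    by rewrite mulrDr da db addr0.
  by rewrite mulrCA da mulr0.
by move=> b eb /=; apply: dual_orth.
Qed.

Lemma dual_coef t (c : nat -> K) i v : (i < size (e t))%N ->
    ideal_span (e t.+1) (v - \sum_(j < size (e t)) c j *: (e t)`_j) ->
  ell ((d t)`_i * v) = c i.
Proof.
move=> it /(dual_orth_span it) /eqP; rewrite mulrBr subr_eq0 => /eqP ->.
rewrite mulr_sumr ell_sum (bigD1 (Ordinal it)) //= big1 ?addr0 => [|j ji].
  by rewrite -scalerAr ellZ dual_pairing // eqxx mulr1.
rewrite -scalerAr ellZ dual_pairing // (_ : _ == _ = false) ?mulr0 //.
by apply: contraNF ji => /eqP ij; apply/eqP/val_inj.
Qed.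

Lemma filt_quot_dim t : quot_dim (ideal_pow M t) (ideal_pow M t.+1) (size (e t)).
Proof.
rewrite (ideal_powE t) (ideal_powE t.+1); exists (fun i => (e t)`_i); split.
  by move=> i; apply: ideal_span_mem; apply: mem_nth.
move=> v /filt_expand[c Vc]; exists [ffun i : 'I_(size (e t)) => c i]; split.
  by under eq_bigr => i _ do rewrite ffunE.
move=> c' Vc'; apply/ffunP=> i; rewrite ffunE -(dual_coef (ltn_ord i) Vc).
pose c'' j := if insub j is Some k then c' k else 0.
have cE (j : 'I_(size (e t))) : c'' j = c' j by rewrite /c'' valK.
rewrite -cE; apply: dual_coef => //.
by under eq_bigr => j _ do rewrite cE.
Qed.

(** If v is in the t-th step, then its coefficients on e t are the values of
    ell on multiples of v; when these vanish, v is in the next step. *)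
Lemma filt_nondegenerate v : (forall a, ell (a * v) = 0) -> v = 0.
Proof.
move=> v0; suff Vv t : ideal_span (e t) v.
  by move: (Vv N); rewrite filt_end => /ideal_span_nil.
elim: t => [|t /filt_expand[c Vc]].
  rewrite -ideal_powE; exact: I.
have c0 (i : 'I_(size (e t))) : c i *: (e t)`_i = 0.
  by rewrite -(dual_coef (ltn_ord i) Vc) v0 scale0r.
by move: Vc; rewrite big1 ?subr0.
Qed.

(** A is finite dimensional over K: the members of the families e t span it. *)
Lemma filt_artinian : artinian A.
Proof.
move=> J Jid Jdec.
suff [s As] : exists s : seq A, [set: A] `<=` lin_span s.
  apply: (lin_span_dcc (s := s)) => // [i|i c a b Ja Jb|]; last by move=> a _; apply: As.
    by have [] := Jid i.
  have [_ JD JM] := Jid i; apply: JD => //.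
  by rewrite -[a]mul1r scalerAl; apply: JM.
suff: forall t, exists s : seq A, ideal_span (e (N - t)) `<=` lin_span s.
  move=> /(_ N)[s As]; exists s => a _; apply: As.
  by rewrite subnn -ideal_powE.
elim=> [|t [s Vs]].
  by exists [::] => a; rewrite subn0 filt_end => /ideal_span_nil ->.
have [tN|Nt] := ltnP t N; last first.
  by exists s; move: Vs; rewrite (eqP Nt) (eqP (leqW Nt)).
exists (e (N - t.+1) ++ s) => v /filt_expand[c]; rewrite -subSn // subSS => Vc.
by apply: (lin_span_cat (c := c)); apply: Vs.
Qed.

Lemma filt_nilpotent a : M a -> a ^+ N = 0.
Proof.
move=> Ma; suff aV t : ideal_span (e t) (a ^+ t).
  by have := aV N; rewrite filt_end => /ideal_span_nil.
elim: t => [|t IHt]; first by rewrite -ideal_powE.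
by rewrite exprSr; apply: filt_mulM.
Qed.

Lemma filt_proper : ~ M 1.
Proof.
move=> M1; have s0 : (0 < size (e 0))%N by rewrite filt0.
have V1 : ideal_span (e 1) 1.
  rewrite -[1]mulr1; apply: filt_mulM => //.
  by rewrite filt0; apply: ideal_span_mem; rewrite mem_head.
have := dual_pairing s0 s0; rewrite filt0 /= dual_orth_span // ell0.
by move/esym/eqP; rewrite oner_eq0.
Qed.

(** An ideal that contains M and an element c + m with c nonzero in K and m in
    M contains 1, so M is maximal; and M consists of nilpotent elements, so it
    is contained in every maximal ideal. *)
Lemma filt_local : local_ring M.
Proof.
have M1 := filt_proper; have idM := is_ideal_span xs.
have maxM : maximal_ideal M.
  split=> // J [J0 JD JM] J1 MJ; apply/seteqP; split=> // a Ja.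
  have [k Mk] := residue a; have [k0|k0] := eqVneq k 0.
    by move: Mk; rewrite k0 scale0r subr0.
  case: J1; rewrite (_ : 1 = k^-1%:A * (a - (a - k%:A))).
    by apply/JM/JD => //; rewrite -mulN1r; apply/JM/MJ.
  by rewrite opprB addrC subrK -scalerAl mul1r scalerA mulVf // scale1r.
split=> // M' [idM' M'1 maxM'].
have [M'0 M'D M'M] := idM'; have [_ MD MM] := idM.
have [_ _ maxM2] := maxM; apply: maxM2 => // m Mm; apply: contrapT => M'm.
pose J a := exists r, M' (a - r * m).
have [r M'r] : J 1.
  apply: contrapT => J1; apply: M'm; rewrite -(maxM' J) //.
  - by exists 1; rewrite mul1r subrr.
  - split=> [|a b [r Ja] [r' Jb]|c a [r Ja]].
    + by exists 0; rewrite mul0r subr0.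
    + exists (r + r'); rewrite (_ : _ - _ = (a - r * m) + (b - r' * m)); last by ring.
      exact: M'D.
    + exists (c * r); rewrite (_ : _ - _ = c * (a - r * m)); last by ring.
      exact: M'M.
  - by move=> a M'a; exists 0; rewrite mul0r subr0.
apply: M'1; have := subrX1 (r * m) N.
rewrite filt_nilpotent; last exact: MM.
move/eqP; rewrite sub0r eqr_oppLR -mulNr opprB mulrC => /eqP ->; exact: M'M.
Qed.

Lemma filt_hilbert_function : hilbert_function A (fun t => size (e t)).
Proof. by exists M; split=> [|t]; [exact: filt_local|exact: filt_quot_dim]. Qed.

End DualFiltration.

(** * Monomials and monomial ideals in power series rings *)

Section Monomials.

Variables (n : nat) (K : comNzRingType).

Local Notation R := (mpseries n K).

Implicit Types (r s t : R) (k l m : 'X_{1..n}) (i j : 'I_n).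

Definition mon k : R := MPSeries (fun m => (m == k)%:R).

Lemma mpsaddE r s m : (r + s) m = r m + s m. Proof. by []. Qed.
Lemma mpsoppE r m : (- r) m = - r m. Proof. by []. Qed.
Lemma mpszeroE m : (0 : R) m = 0. Proof. by []. Qed.

Lemma mon_mulE k r m : (mon k * r) m = if (k <= m)%MM then r (m - k)%MM else 0.
Proof.
rewrite [LHS]/=; case: ifPn => [km|km].
  have kd : (mdeg k < (mdeg m).+1)%N.
    by rewrite ltnS -[m in leqRHS](submK km) mdegD leq_addl.
  rewrite (bigD1 (BMultinom kd)) //= eqxx mul1r big1 ?addr0 // => l /andP[_].
  by rewrite -val_eqE /= => /negbTE ->; rewrite mul0r.
by rewrite big1 // => l lm; case: eqP => [lk|_]; [rewrite -lk lm in km|rewrite mul0r].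
Qed.

Lemma mon_mul_shift k r m : (mon k * r) (m + k)%MM = r m.
Proof. by rewrite mon_mulE lem_addl addmK. Qed.

Lemma monD k l : mon (k + l) = mon k * mon l.
Proof.
apply: mpseriesP => m; rewrite mon_mulE /=; case: ifPn => km.
  by rewrite -[m in LHS](submK km) addmC (inj_eq (@addmI n k)).
by case: eqP => // mE; rewrite mE lem_addr in km.
Qed.

Lemma mpsXn i p : mpsX K i ^+ p = mon (U_(i) *+ p)%MM.
Proof.
elim: p => [|p IHp]; first by rewrite expr0 mulm0n.
by rewrite exprS IHp -monD mulmS.
Qed.

Lemma mon_mulI k : injective ( *%R (mon k)).
Proof.
by move=> r s rs; apply: mpseriesP => m; rewrite -[LHS](mon_mul_shift k) rs mon_mul_shift.
Qed.

(** A series supported on multiples of the generators is in the ideal: split off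
    the terms divisible by the first generator, which form a multiple of it. *)
Lemma mem_monomial_ideal (ls : seq 'X_{1..n}) r :
  ideal_span (map mon ls) r <->
  forall m, ~~ has (fun l => (l <= m)%MM) ls -> r m = 0.
Proof.
split.
  move: r; apply: (@ideal_span_le _
    [set r : R | forall m, ~~ has (fun l => (l <= m)%MM) ls -> r m = 0]).
    split=> //= [r s r0 s0 m lm|r s s0 m lm]; first by rewrite r0 // s0 // addr0.
    rewrite big1 // => k km; rewrite s0 ?mulr0 //.
    apply: contra lm => /hasP[l lls lm]; apply/hasP; exists l => //.
    exact: lepm_trans lm (lem_subr _ _).
  move=> _ /mapP[l lls ->] m /= /hasPn /(_ _ lls).
  by case: eqP => // ->; rewrite lepm_refl.
elim: ls r => [|l ls IHls] r r0.
  by apply/ideal_span_nil/mpseriesP => m; apply: r0.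
apply/ideal_span_cons; exists (MPSeries (fun m => r (m + l)%MM)).
apply: IHls => m lsm; rewrite mulrC mpsaddE mpsoppE mon_mulE; case: ifPn => lm.
  by rewrite /= submK // subrr.
by rewrite subr0 r0 //= negb_or lm.
Qed.

(** When multiplication by the monomial k does not create divisibility by the
    generators, k is a nonzerodivisor modulo the monomial ideal.  This is
    how congruences modulo powers of variables are solved below. *)
Lemma monomial_ideal_colon k (ls : seq 'X_{1..n}) r :
    (forall l m, l \in ls -> (l <= m + k)%MM -> (l <= m)%MM) ->
  ideal_span (map mon ls) (mon k * r) -> ideal_span (map mon ls) r.
Proof.
move=> lsk /mem_monomial_ideal kr; apply/mem_monomial_ideal => m lsm.
rewrite -(mon_mul_shift k) kr //; apply: contra lsm => /hasP[l lls lm].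
by apply/hasP; exists l => //; apply: lsk.
Qed.

Lemma lepm_pow i p m : (U_(i) *+ p <= m)%MM = (p <= m i)%N.
Proof.
apply/mnm_lepP/idP => [/(_ i)|pm j]; rewrite mulmnE mnm1E ?eqxx ?mul1n //.
by case: eqP => [<-|_]; rewrite ?mul1n.
Qed.

Lemma pow_colon1 i j p q r s : i != j ->
  mpsX K i ^+ p * r = mpsX K j ^+ q * s -> exists t, r = mpsX K j ^+ q * t.
Proof.
move=> ij; rewrite !mpsXn => E; pose J := [:: (U_(j) *+ q)%MM].
have /ideal_span1[c ->] : ideal_span (map mon J) r; last by exists c; rewrite mulrC.
apply: (@monomial_ideal_colon (U_(i) *+ p)%MM).
  move=> l m; rewrite inE => /eqP ->.
  by rewrite !lepm_pow mnmDE mulmnE mnm1E (negbTE ij) addn0.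
by apply/ideal_span1; exists s; rewrite E mulrC.
Qed.

Lemma pow_colon2 i j (k : 'I_n) p q q' r s t : i != j -> i != k ->
    mpsX K i ^+ p * r = mpsX K j ^+ q * s + mpsX K k ^+ q' * t ->
  exists s' t', r = mpsX K j ^+ q * s' + mpsX K k ^+ q' * t'.
Proof.
move=> ij ik; rewrite !mpsXn => E; pose J := [:: U_(j) *+ q; U_(k) *+ q']%MM.
have /ideal_span2[c [c' ->]] : ideal_span (map mon J) r; last first.
  by exists c, c'; rewrite ![mon _ * _]mulrC.
apply: (@monomial_ideal_colon (U_(i) *+ p)%MM).
  move=> l m; rewrite !inE => /orP[] /eqP ->;
  by rewrite !lepm_pow mnmDE mulmnE mnm1E ?(negbTE ij) ?(negbTE ik) addn0.
by apply/ideal_span2; exists s, t; rewrite E ![mon _ * _]mulrC.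
Qed.

End Monomials.

(** * Completeness with respect to a variable *)

Section AdicDescent.

Variables (n : nat) (K : comNzRingType) (i : 'I_n).

Local Notation R := (mpseries n K).
Local Notation x := (mpsX K i).

Lemma mpsX_mulE (r : R) m :
  (x * r) m = if (0 < m i)%N then r (m - U_(i))%MM else 0.
Proof. by rewrite (mon_mulE U_(i)) -[U_(i)%MM in X in if X then _ else _]mulm1n lepm_pow. Qed.

Lemma mpsX_mulI : injective ( *%R x).
Proof. exact: (@mon_mulI n K U_(i)%MM). Qed.

Lemma adic_separated (D : nat -> R) : (forall N, D N = x * D N.+1) ->
  forall N, D N = 0.
Proof.
move=> DS N; apply: mpseriesP => m; rewrite mpszeroE.
move: {2}(m i) (leqnn (m i)) => p; elim: p N m => [|p IHp] N m mp.
  by rewrite DS mpsX_mulE ltnNge mp.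
rewrite DS mpsX_mulE; case: ifP => // m0; apply: IHp.
by rewrite mnmBE mnm1E eqxx leq_subLR add1n.
Qed.

(** S N is the sum of the X_i^k al (N + k), which converges coefficientwise. *)
Lemma adic_series (al : nat -> R) : exists S : nat -> R,
  forall N, S N = al N + x * S N.+1.
Proof.
exists (fun N => MPSeries (fun m =>
  \sum_(k < (m i).+1) al (N + k)%N (m - U_(i) *+ k)%MM)) => N.
apply: mpseriesP => m; rewrite mpsaddE mpsX_mulE /= big_ord_recl /= addn0 mulm0n subm0.
congr (_ + _); case: ifPn => m0; last by rewrite big1 // => -[k /= km]; lia.
rewrite mnmBE mnm1E eqxx subn1 prednK //; apply: eq_bigr => k _.
by rewrite /bump /= add1n addnS addSn mulmS submDA.
Qed.

(** If elements of P can be divided by f forever with a remainder in X_i P,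
    then the quotients add up to a convergent series, so the ideal (f) is
    reached in the limit.  With f = 0 this proves vanishing. *)
Lemma adic_descent (P : R -> Prop) (f : R) :
    (forall r, P r -> exists al r', P r' /\ r = al * f + x * r') ->
  forall r, P r -> exists c, r = c * f.
Proof.
move=> step r0 Pr0.
have /choice[g gP] : forall r : {r | P r}, exists al : R * {r | P r},
    sval r = al.1 * f + x * sval al.2.
  by move=> [r Pr]; have [al [r' [Pr' E]]] := step r Pr; exists (al, exist _ r' Pr').
pose rs N := iter N (fun r => (g r).2) (exist _ r0 Pr0).
have [S SE] := adic_series (fun N => (g (rs N)).1).
exists (S 0%N); apply/eqP; rewrite -subr_eq0; apply/eqP.
apply: (@adic_separated (fun N => sval (rs N) - S N * f) _ 0%N) => N.
by rewrite [sval (rs N)]gP SE /=; ring.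
Qed.

(** The inverse is the geometric series of X_i w. *)
Lemma adic_unit (w : R) : exists s, (1 - x * w) * s = 1.
Proof.
have [S SE] := adic_series (fun N => w ^+ N); exists (S 0%N).
have : S 1%N - w * S 0%N = 0.
  apply: (@adic_separated (fun N => S N.+1 - w * S N) _ 0%N) => N.
  by rewrite /= {1}(SE N.+1) {1}(SE N) exprS; ring.
move/eqP; rewrite subr_eq0 => /eqP S1.
by rewrite mulrBl mul1r {1}SE S1 expr0 mulrA addrK.
Qed.

End AdicDescent.

(** * Regular sequences *)

Section RegularSequences.

Variables (n : nat) (K : comNzRingType).

Local Notation R := (mpseries n K).

Implicit Types (r s t : R).

(** For linear consequences of an equation: the difference of the two sides is
    left to a ring normalization. *)
Lemma eq_by_diff (A : zmodType) (l l' p q : A) : l = l' -> p - q = l - l' -> p = q.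
Proof. by move=> ->; rewrite subrr => /eqP; rewrite subr_eq0 => /eqP. Qed.

Section BranchCurve.

Variables (i j k : 'I_n) (a b : nat).
Hypotheses (ij : i != j) (ik : i != k) (jk : j != k).

Local Notation x := (mpsX K i).
Local Notation y := (mpsX K j).
Local Notation z := (mpsX K k).
Local Notation f := (y * z - x ^+ a.+2).
Local Notation g := (x * z - y ^+ b.+2).
Local Notation rho := (z ^+ 2 - x ^+ a.+1 * y ^+ b.+1).

(** The relation y z r = x^(a+2) r shows that y divides r, and the quotient is
    again killed by f. *)
Lemma surface_regular r : f * r = 0 -> r = 0.
Proof.
move=> fr; have [s Ps|] := @adic_descent n K j (fun r => f * r = 0) 0 _ r fr; last first.
  by move=> c ->; rewrite mulr0.
have [t st] : exists t, s = y ^+ 1 * t.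
  apply: (@pow_colon1 _ _ i j a.+2 1 s (z * s)) => //.
  rewrite mulrA expr1; apply/esym/eqP; rewrite -subr_eq0 -mulrBl; exact/eqP.
exists 0, t; rewrite mulr0 add0r; split=> //.
by apply: (@mpsX_mulI n K j); rewrite mulr0 mulrCA -[X in X * t]expr1 -st.
Qed.

(** Restriction to x = y = 0, where f and g vanish and rho is z^2. *)
Lemma axis_rho al s t u v : al * rho + u * f + v * g = x * s + y * t ->
  exists al1 al2, al = x * al1 + y * al2.
Proof.
move=> E; apply: (@pow_colon2 _ _ k i j 2 1 1 _
    (s + al * x ^+ a * y ^+ b.+1 + u * x ^+ a.+1 - v * z)
    (t - u * z + v * y ^+ b.+1)); rewrite 1?eq_sym //.
by apply: (eq_by_diff E); rewrite !exprS; ring.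
Qed.

(** Modulo y, and after division by x, the relation reads al x^(a+1) = be z;
    solving it shows that r is a multiple of rho up to elements of (f, g).  As r vanishes
    on x = y = 0 and rho does not, the multiplier is in (x, y), and both x rho
    and y rho are in (f, g). *)
Lemma curve_cancel_y r r1 r2 al be : r = x * r1 + y * r2 ->
  y * r = al * f + be * g -> exists al be, r = al * f + be * g.
Proof.
move=> rxy E; have ji : j != i by rewrite eq_sym.
have ki : k != i by rewrite eq_sym.
have kj : k != j by rewrite eq_sym.
have [s Es] : exists s, be * z - al * x ^+ a.+1 = y ^+ 1 * s.
  apply: (@pow_colon1 _ _ i j 1 1 _ (r - al * z + be * y ^+ b.+1)) => //.
  by apply: (eq_by_diff (esym E)); rewrite !exprS; ring.
have [al' [al'' Eal]] : exists s t, al = z ^+ 1 * s + y ^+ 1 * t.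
  apply: (@pow_colon2 _ _ i k j a.+1 1 1 _ be (- s)) => //.
  by apply: (eq_by_diff (esym Es)); rewrite !exprS; ring.
have [be'' Ebe] : exists t, be - x ^+ a.+1 * al' = y ^+ 1 * t.
  apply: (@pow_colon1 _ _ k j 1 1 _ (s + x ^+ a.+1 * al'')) => //.
  by apply: (eq_by_diff Es); rewrite Eal !exprS; ring.
have {}Ebe : be = x ^+ a.+1 * al' + y * be''.
  by apply: (eq_by_diff Ebe); rewrite !exprS; ring.
have Er : r = al' * rho + al'' * f + be'' * g.
  apply: (@mpsX_mulI n K j); rewrite E Eal Ebe !exprS; ring.
have [al1 [al2 E']] : exists al1 al2, al' = x * al1 + y * al2.
  by apply: (@axis_rho _ r1 r2 al'' be''); rewrite -Er.
exists (al1 * y ^+ b.+1 + al2 * z + al''), (al1 * z + al2 * x ^+ a.+1 + be'').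
by rewrite Er E' !exprS; ring.
Qed.

(** Modulo x, and after division by y, the relation reads al z = - r y^(b+1), so
    r = x r' - z al' and r' g = al' rho + al'' f.  On x = y = 0 this forces al'
    to be in (x, y), so that al' rho is in (f, g); collecting terms, r is a
    multiple of f plus x times an element satisfying the same hypothesis. *)
Lemma curve_regular al r : g * r = al * f -> exists c, r = c * f.
Proof.
have ji : j != i by rewrite eq_sym.
move=> E; apply: (@adic_descent n K i (fun r => exists al, g * r = al * f)); last first.
  by exists al.
move=> {E al} {}r [al E].
have [s Es] : exists s, al * z + r * y ^+ b.+1 = x ^+ 1 * s.
  apply: (@pow_colon1 _ _ j i 1 1 _ (r * z + al * x ^+ a.+1)) => //.
  by apply: (eq_by_diff (esym E)); rewrite !exprS; ring.
have [al' [al'' Eal]] : exists s t, al = y ^+ b.+1 * s + x ^+ 1 * t.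
  apply: (@pow_colon2 _ _ k j i 1 b.+1 1 _ (- r) s); rewrite 1?eq_sym //.
  by apply: (eq_by_diff Es); rewrite !exprS; ring.
have [r' Er] : exists t, z * al' + r = x ^+ 1 * t.
  apply: (@pow_colon1 _ _ j i b.+1 1 _ (s - z * al'')) => //.
  by apply: (eq_by_diff Es); rewrite Eal !exprS; ring.
have {}Er : r = x * r' - z * al' by apply: (eq_by_diff Er); rewrite !exprS; ring.
have E' : r' * g = al' * rho + al'' * f.
  apply: (@mpsX_mulI n K i); apply: (eq_by_diff E); rewrite Er Eal !exprS; ring.
have [al1 [al2 E'']] : exists al1 al2, al' = x * al1 + y * al2.
  apply: (@axis_rho _ (r' * z) (- r' * y ^+ b.+1) al'' 0).
  by apply: (eq_by_diff (esym E')); rewrite !exprS; ring.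
exists (- al2), (r' - z * al1 - x ^+ a.+1 * al2); split; last first.
  by rewrite Er E'' !exprS; ring.
exists (al'' + y ^+ b.+1 * al1 + z * al2).
by apply: (eq_by_diff E'); rewrite E'' !exprS; ring.
Qed.

End BranchCurve.
Section Cusp.

Variables (i j k : 'I_n) (a b c : nat).
Hypotheses (ij : i != j) (ik : i != k) (jk : j != k).

Local Notation x := (mpsX K i).
Local Notation y := (mpsX K j).
Local Notation z := (mpsX K k).
Local Notation f := (y * z - x ^+ a.+3).
Local Notation g := (x * z - y ^+ b.+2).
Local Notation p := (x * y - z ^+ c.+2).
Local Notation rho := (z ^+ 2 - x ^+ a.+2 * y ^+ b.+1).

(** Uses p = xy (1 - w) - z^c rho, where w is a multiple of x because the exponent
    of x in f is at least 3. *)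
Lemma point_regular r al be : p * r = al * f + be * g ->
  exists al be, r = al * f + be * g.
Proof.
have [ji ki kj] : [/\ j != i, k != i & k != j] by rewrite [j == i]eq_sym [k == i]eq_sym [k == j]eq_sym.
move=> E.
have [r1 [r2 Er]] : exists r1 r2, r = x ^+ 1 * r1 + y ^+ 1 * r2.
  apply: (@pow_colon2 _ _ k i j c.+2 1 1 _ (y * r + al * x ^+ a.+2 - be * z)
      (- al * z + be * y ^+ b.+1)) => //.
  by apply: (eq_by_diff (esym E)); rewrite !exprS; ring.
have [s sw] := @adic_unit n K i (x ^+ a * y ^+ b * z ^+ c).
have [al1 [be1 E1]] : exists al be, x * r = al * f + be * g.
  apply: (@curve_cancel_y i j k a.+1 b ij ik jk _ r 0
    (s * (al + z ^+ c * (r1 * y ^+ b.+1 + r2 * z)))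
    (s * (be + z ^+ c * (r1 * z + r2 * x ^+ a.+2)))).
    by rewrite mulr0 addr0.
  rewrite -[y * _]mul1r -sw.
  have E2 : s * (p * r) = s * (al * f + be * g) by rewrite E.
  by apply: (eq_by_diff E2); rewrite Er !exprS; ring.
have [be2 [al2 ->]] := @curve_cancel_y j i k b a.+1 ji jk ik r r2 r1 be1 al1
  (etrans Er (addrC _ _)) (etrans E1 (addrC _ _)).
by exists al2, be2; rewrite addrC.
Qed.

Lemma cusp_regular_sequence : regular_sequence [:: f; g; p].
Proof.
split.
  pose ls := [:: U_(i); U_(j); U_(k)]%MM.
  have [_ SD SM] := is_ideal_span (map (@mon n K) ls).
  have idS := is_ideal_span (map (@mon n K) ls).
  have Sx l m : l \in [:: i; j; k] -> ideal_span (map (@mon n K) ls) (m * mpsX K l).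
    move=> lijk; apply: SM; apply: ideal_span_mem; apply: (@map_f _ _ (@mon n K) _ U_(l)%MM).
    by move: lijk; rewrite !inE => /or3P[] /eqP ->; rewrite eqxx ?orbT.
  suff: ideal_span [:: f; g; p] `<=` ideal_span (map (@mon n K) ls).
    move=> sub /sub /mem_monomial_ideal /(_ 0%MM) /=.
    rewrite -[U_(i)%MM]mulm1n -[U_(j)%MM]mulm1n -[U_(k)%MM]mulm1n.
    rewrite !lepm_pow !mnm0E eqxx => /(_ isT) /eqP.
    by rewrite oner_eq0.
  apply: ideal_span_le => // h; rewrite !inE => /or3P[] /eqP ->.
  - by rewrite exprSr; apply: (idealB idS); apply: Sx; rewrite !inE eqxx ?orbT.
  - by rewrite exprSr; apply: (idealB idS); apply: Sx; rewrite !inE eqxx ?orbT.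
  - by rewrite exprSr; apply: (idealB idS); apply: Sx; rewrite !inE eqxx ?orbT.
case=> [|[|[|//]]] _ r /=.
- move/ideal_span_nil=> fr; apply/ideal_span_nil.
  exact: (@surface_regular i j k a.+1 ij r fr).
- move/ideal_span1=> [al E]; apply/ideal_span1.
  exact: (curve_regular ij ik jk E).
- move/ideal_span2=> [al [be E]]; apply/ideal_span2.
  exact: point_regular E.
Qed.

End Cusp.

Lemma power_regular_sequence (i j k : 'I_n) : i != j -> i != k -> j != k ->
  regular_sequence [:: mpsX K i ^+ 2; mpsX K j ^+ 2; mpsX K k ^+ 2].
Proof.
move=> ij ik jk; have [ji ki kj] : [/\ j != i, k != i & k != j].
  by rewrite [j == i]eq_sym [k == i]eq_sym [k == j]eq_sym.
split.
  rewrite !mpsXn => /(@mem_monomial_ideal n K [:: U_(i) *+ 2; U_(j) *+ 2; U_(k) *+ 2]%MM).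
  move=> /(_ 0%MM) /=; rewrite !lepm_pow !mnm0E eqxx => /(_ isT) /eqP.
  by rewrite oner_eq0.
case=> [|[|[|//]]] _ r /=.
- move/ideal_span_nil=> xr; apply/ideal_span_nil.
  by rewrite mpsXn in xr; apply: (@mon_mulI n K (U_(i) *+ 2)%MM); rewrite xr mulr0.
- move/ideal_span1=> [al E]; apply/ideal_span1; rewrite [RHS]mulrC in E.
  by have [t ->] := pow_colon1 ji E; exists t; rewrite mulrC.
- move/ideal_span2=> [al [be E]]; apply/ideal_span2; rewrite ![_ * _ ^+ 2]mulrC in E.
  by have [t [t' ->]] := pow_colon2 ki kj E; exists t, t'; rewrite ![_ * _ ^+ 2]mulrC.
Qed.

End RegularSequences.

(** * Annihilators and the dual generator of a quotient *)

Section Quotients.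

Variable R : comNzRingType.

Lemma exists_idealr (J : set R) : is_ideal J -> ~ J 1 ->
  exists I : idealr R, [set` I] = J.
Proof.
move=> [J0 JD JM] J1; pose S : R -> bool := fun r => `[< J r >].
have S_closed : idealr_closed S.
  split=> [||a u v]; [exact/asboolP|exact/asboolPn|].
  by move=> /asboolP Ju /asboolP Jv; apply/asboolP/JD => //; apply: JM.
pose I : idealr R := HB.pack S (isIdealr.Build R S S_closed).
exists I; apply/seteqP; split=> a; first by move=> /asboolP.
by move=> Ja; apply/asboolP.
Qed.

Variables (I : idealr R) (gs : seq R).
Hypothesis IE : [set` I] = ideal_span gs.

Local Notation Q := {ideal_quot I}.
Local Notation "[ 'class' r ]" := (\pi_Q%qT r : Q).

Lemma quot_eq0 r : [class r] = 0 <-> ideal_span gs r.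
Proof.
rewrite -IE /= -[0](rmorph0 (\pi_Q%qT : {rmorphism R -> Q})); split.
  by move=> /eqP; rewrite -Quotient.idealrBE subr0.
by move=> Ir; apply/eqP; rewrite -Quotient.idealrBE subr0.
Qed.

Lemma quot_span s r : ideal_span (gs ++ s) r ->
  ideal_span (map (fun r => [class r]) s) [class r].
Proof.
have [S0 SD SM] := is_ideal_span (map (fun r => [class r]) s).
move: r; apply: (@ideal_span_le _
    [set r | ideal_span (map (fun r => [class r]) s) [class r]]).
  split=> [|a b Sa Sb|a b Sb] /=.
  - by rewrite rmorph0.
  - by rewrite rmorphD; apply: SD.
  - by rewrite rmorphM; apply: SM.
move=> r; rewrite mem_cat => /orP[gr|sr] /=.
  by have /quot_eq0 -> := ideal_span_mem gr.
by apply: ideal_span_mem; apply: map_f.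
Qed.

Lemma nth_class s i : (map (fun r => [class r]) s)`_i = [class s`_i].
Proof.
have [si|si] := ltnP i (size s); first by rewrite (nth_map 0).
by rewrite !nth_default ?size_map // rmorph0.
Qed.

End Quotients.

Section Pairing.

Variables (n : nat) (K : comNzRingType).

Local Notation R := (mpseries n K).

Implicit Types (r s : R) (F G : {mpoly K[n]}).

Definition pairing F r : K := \sum_(j <- msupp F) r j * F@_j.

Lemma pairingE d F r : (msize F <= d)%N ->
  pairing F r = \sum_(j : 'X_{1..n < d}) r j * F@_j.
Proof.
move=> Fd; rewrite /pairing (big_mksub 'X_{1..n < d}) //=; first last.
- by move=> x /msize_mdeg_lt /leq_trans; apply.
- by rewrite msupp_uniq.
by rewrite big_rmcond //= => i /memN_msupp_eq0 ->; rewrite mulr0.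
Qed.

Lemma pairingDl F G r : pairing (F + G) r = pairing F r + pairing G r.
Proof.
pose d := maxn (msize (F + G)) (maxn (msize F) (msize G)).
rewrite !(@pairingE d) ?/d ?leq_max ?leqnn ?orbT // -big_split /=.
by apply: eq_bigr => j _; rewrite mcoeffD mulrDr.
Qed.

Lemma pairingX j r : pairing 'X_[j] r = r j.
Proof. by rewrite /pairing msuppX big_seq1 mcoeffX eqxx mulr1. Qed.

Lemma pairing_linear F (c : K) r s :
  pairing F (c *: r + s) = c * pairing F r + pairing F s.
Proof.
rewrite /pairing mulr_sumr -big_split /=; apply: eq_bigr => j _.
by rewrite mulrDl mulrA.
Qed.

Lemma pairingB F r s : pairing F (r - s) = pairing F r - pairing F s.
Proof. by rewrite addrC -scaleN1r pairing_linear mulN1r addrC. Qed.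

(** The coefficients of the contraction are values of the pairing, which turns
    statements on Ann F into statements on a single linear form. *)
Lemma mcoeff_contract r F m : (contract r F)@_m = pairing F (mon K m * r).
Proof.
rewrite /contract raddf_sum; apply: eq_bigr => j _; rewrite mon_mulE raddf_sum /=.
case: ifPn => [mj|mj]; last first.
  rewrite big1 ?mul0r // => k kj; rewrite mcoeffZ mcoeffX.
  by case: eqP => [E|]; rewrite ?mulr0 //; rewrite -E lem_subr in mj.
have jm : (mdeg (j - m) < (mdeg j).+1)%N by rewrite ltnS mdegB.
rewrite (bigD1 (BMultinom jm)) ?lem_subr //= mcoeffZ mcoeffX.
rewrite submBA // addmC addmK eqxx mulr1 big1 ?addr0 // => k /andP[kj].
rewrite -val_eqE /= mcoeffZ mcoeffX => kjm; case: eqP => [E|]; rewrite ?mulr0 //.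
by move: kjm; rewrite -E submBA // addmC addmK eqxx.
Qed.

(** Only finitely many coefficients of s r are seen by F, and these agree with
    those of a finite combination of monomial multiples of r. *)
Lemma AnnP F r : Ann F r <-> forall s, pairing F (s * r) = 0.
Proof.
split=> [/= r0 s|Fr]; last by apply/mpolyP => m; rewrite mcoeff_contract mcoeff0.
pose d := msize F; rewrite (pairingE _ (leqnn d)).
transitivity (\sum_(k : 'X_{1..n < d}) s k * pairing F (mon K k * r)); last first.
  by rewrite big1 // => k _; rewrite -mcoeff_contract r0 mcoeff0 mulr0.
under [RHS]eq_bigr => k _ do rewrite (pairingE _ (leqnn d)) mulr_sumr.
rewrite exchange_big; apply: eq_bigr => j _.
have jd := bmdeg j.
rewrite [(s * r) j](mpsmul_trunc s r jd) (mcoeff_poly_mul_lin _ _ jd) mulr_suml.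
rewrite big_mkcond; apply: eq_bigr => k _; rewrite mon_mulE.
case: ifP => _; last by rewrite mul0r mulr0.
rewrite !mcoeff_mpstrunc bmdeg (leq_ltn_trans (mdegB _ _) jd).
by rewrite mulrA.
Qed.

End Pairing.

(** The transfer to a quotient of a power series ring: a functional that
    vanishes on the ideal of gs descends to the quotient, where the relations
    between the families e t and d t only have to hold modulo gs. *)
Section DualGenerator.

Variables (n : nat) (K : fieldType).

Local Notation R := (mpseries n K).

Variables (F : {mpoly K[n]}) (gs xs : seq R) (e d : nat -> seq R) (N : nat).

Hypothesis gs_regular : regular_sequence gs.
Hypothesis gs_pairing : forall g r, g \in gs -> pairing F (r * g) = 0.
Hypothesis residue : forall r : R, exists c : K, ideal_span xs (r - c%:A).
Hypothesis filt0 : e 0%N = [:: 1].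
Hypothesis filt_prod : forall t a, a \in e t.+1 ->
  exists2 b, b \in e t & exists2 x, x \in xs & a = b * x.
Hypothesis filt_mul : forall t a x, a \in e t -> x \in xs ->
  ideal_span (gs ++ e t.+1) (a * x).
Hypothesis filt_end : e N = [::].
Hypothesis dual_pairing : forall t i j, (i < size (e t))%N -> (j < size (e t))%N ->
  pairing F ((d t)`_i * (e t)`_j) = (i == j)%:R.
Hypothesis dual_orth : forall t i b, (i < size (e t))%N -> b \in e t.+1 ->
  ideal_span gs ((d t)`_i * b).

Local Notation J := (ideal_span gs).

Lemma pairing_span r : J r -> pairing F r = 0.
Proof.
move: r; suff sub : J `<=` [set r | forall s, pairing F (s * r) = 0].
  by move=> r /sub /(_ 1) /=; rewrite mul1r.
apply: ideal_span_le => [|g gg s]; last exact: gs_pairing.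
split=> /= [s|a b a0 b0 s|a b b0 s].
- by rewrite mulr0 /pairing big1 // => j _; rewrite mul0r.
- by rewrite mulrDr -[s * a]scale1r pairing_linear a0 b0 mulr0 addr0.
- by rewrite mulrA.
Qed.

Lemma ideal_span_Ann r : J r -> Ann F r.
Proof.
by move=> Jr; apply/AnnP => s; apply: pairing_span; have [_ _] := is_ideal_span gs; apply.
Qed.

Theorem Ann_dual_generator :
  [/\ Ann F = J, complete_intersection J &
      quotient_hilbert_function J (fun t => size (e t))].
Proof.
have [I IE] := exists_idealr (is_ideal_span gs) gs_regular.1.
pose Q : comAlgType K := {ideal_quot I}.
pose cl (r : R) : Q := \pi_{ideal_quot I}%qT r.
have clK (a : Q) : cl (repr (a : {ideal_quot I})) = a by exact: reprK.
have clM r s : cl (r * s) = cl r * cl s by rewrite /cl rmorphM.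
have clD r s : cl (r + s) = cl r + cl s by rewrite /cl rmorphD.
have cl0 r : cl r = 0 <-> J r by exact: quot_eq0.
have clZ (c : K) r : cl (c *: r) = c *: cl r.
  by rewrite -[r in LHS]mul1r scalerAl clM.
have clB r s : cl (r - s) = cl r - cl s by rewrite /cl rmorphB.
(* The choice of representatives is harmless: the pairing vanishes on J. *)
pose ell (a : Q) := pairing F (repr (a : {ideal_quot I})).
have ellE r : ell (cl r) = pairing F r.
  apply/eqP; rewrite -subr_eq0 -pairingB pairing_span //.
  by apply/cl0; rewrite clB clK subrr.
have ell_linear (c : K) a b : ell (c *: a + b) = c * ell a + ell b.
  by rewrite -(clK a) -(clK b) -clZ -clD !ellE pairing_linear.
have res (a : Q) : exists c : K, ideal_span (map cl xs) (a - c%:A).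
  have [c Mc] := residue (repr (a : {ideal_quot I})); exists c.
  rewrite -{1}(clK a) (_ : c%:A = cl c%:A); last by rewrite clZ /cl rmorph1.
  rewrite -clB; apply: (quot_span IE); move: Mc.
  apply: ideal_span_le => [|b bxs]; first exact: is_ideal_span.
  by apply: ideal_span_mem; rewrite mem_cat bxs orbT.
pose e' t := map cl (e t); pose d' t := map cl (d t).
have size_e' t : size (e' t) = size (e t) by rewrite size_map.
have nth_cl s i : (map cl s)`_i = cl s`_i by exact: nth_class.
have filt0' : e' 0%N = [:: 1] by rewrite /e' filt0 /= /cl rmorph1.
have filt_prod' t a : a \in e' t.+1 ->
    exists2 b, b \in e' t & exists2 x, x \in map cl xs & a = b * x.
  move=> /mapP[r /filt_prod[b eb [x xxs ->]] ->]; exists (cl b); first exact: map_f.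
  by exists (cl x); [exact: map_f|exact: clM].
have filt_mul' t a x : a \in e' t -> x \in map cl xs ->
    ideal_span (e' t.+1) (a * x).
  move=> /mapP[r er ->] /mapP[y yxs ->]; rewrite -clM.
  by apply: (quot_span IE); apply: filt_mul.
have filt_end' : e' N = [::] by rewrite /e' filt_end.
have dual_pairing' t i j : (i < size (e' t))%N -> (j < size (e' t))%N ->
    ell ((d' t)`_i * (e' t)`_j) = (i == j)%:R.
  by rewrite size_e' => it jt; rewrite !nth_cl -clM ellE dual_pairing.
have dual_orth' t i b : (i < size (e' t))%N -> b \in e' t.+1 -> (d' t)`_i * b = 0.
  rewrite size_e' => it /mapP[r er ->]; rewrite nth_cl -clM.
  by apply/cl0; apply: dual_orth.
split.
- apply/seteqP; split=> [r /AnnP r0|r]; last exact: ideal_span_Ann.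
  apply/cl0; apply: (filt_nondegenerate ell_linear res filt0' filt_prod' filt_mul'
    filt_end' dual_pairing' dual_orth') => a.
  by rewrite -(clK a) -clM ellE.
- exists I; split=> //; last by exists gs.
  exact: (filt_artinian res filt0' filt_prod' filt_mul' filt_end').
- exists I; split=> //.
  have := filt_hilbert_function ell_linear res filt0' filt_prod' filt_mul'
    filt_end' dual_pairing' dual_orth'.
  by congr hilbert_function; apply/funext => t; rewrite size_e'.
Qed.

End DualGenerator.

(** * The monomial complete intersection *)

Section ThreeVariables.

Variables (n : nat) (K : comNzRingType) (i j k : 'I_n).
Hypothesis cover : forall l : 'I_n, l \in [:: i; j; k].

Lemma mnm_cover (P : 'I_n -> Prop) : P i -> P j -> P k -> forall l, P l.
Proof. by move=> Pi Pj Pk l; move: (cover l); rewrite !inE => /or3P[] /eqP ->. Qed.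

Lemma lepm_cover (m m' : 'X_{1..n}) :
  (m <= m')%MM = [&& m i <= m' i, m j <= m' j & m k <= m' k]%N.
Proof.
apply/mnm_lepP/and3P => [le|[li lj lk] l]; first by split; apply: le.
by move: l; apply: mnm_cover.
Qed.

Lemma eqm_cover (m m' : 'X_{1..n}) :
  (m == m') = [&& m i == m' i, m j == m' j & m k == m' k]%N.
Proof.
apply/eqP/and3P => [->|[/eqP ei /eqP ej /eqP ek]]; first by rewrite !eqxx.
by apply/mnmP; apply: mnm_cover.
Qed.

Lemma residue_variables (r : mpseries n K) :
  exists c : K, ideal_span [:: mpsX K i; mpsX K j; mpsX K k] (r - c%:A).
Proof.
exists (r 0%MM); apply: (@mem_monomial_ideal n K [:: U_(i); U_(j); U_(k)]%MM _).2.
move=> m; rewrite -[U_(i)%MM]mulm1n -[U_(j)%MM]mulm1n -[U_(k)%MM]mulm1n /=.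
rewrite !lepm_pow !negb_or => /and4P[m1 m2 m3 _].
have -> : m = 0%MM.
  apply/mnmP => l; rewrite mnm0E; move: (cover l); rewrite !inE.
  by case/or3P=> /eqP ->; apply/eqP; rewrite -leqn0 leqNgt.
by rewrite /= eqxx mulr1 subrr.
Qed.

End ThreeVariables.

Section SquareRelations.

Variables (n : nat) (K : fieldType) (i j k : 'I_n).
Hypotheses (ij : i != j) (ik : i != k) (jk : j != k).
Hypothesis cover : forall l : 'I_n, l \in [:: i; j; k].

Local Notation x := (mpsX K i).
Local Notation y := (mpsX K j).
Local Notation z := (mpsX K k).
Local Notation J := (ideal_span [:: x ^+ 2; y ^+ 2; z ^+ 2]).

Let mnmS := (@mnmDE n, @mnmBE n, @mulmnE n, @mnm1E n, @mnm0E n).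
Let neqs := (negbTE ij, negbTE ik, negbTE jk,
  etrans (eq_sym j i) (negbTE ij), etrans (eq_sym k i) (negbTE ik),
  etrans (eq_sym k j) (negbTE jk), eqxx).

Let squares := [:: U_(i) *+ 2; U_(j) *+ 2; U_(k) *+ 2]%MM.

(** Listed so that the complement of the l-th monomial of degree t in xyz is
    the l-th one of degree 3 - t. *)
Definition squarefree t : seq 'X_{1..n} := nth [::]
  [:: [:: 0]; [:: U_(i); U_(j); U_(k)];
      [:: U_(j) + U_(k); U_(i) + U_(k); U_(i) + U_(j)]; [:: U_(i) + U_(j) + U_(k)]]%MM t.

Lemma mon_mem_span (ls : seq 'X_{1..n}) m :
  has (fun l => l <= m)%MM ls -> ideal_span (map (@mon n K) ls) (mon K m).
Proof.
move=> lsm; apply/mem_monomial_ideal => m' lsm' /=.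
by case: eqP lsm' => // ->; rewrite lsm.
Qed.

Lemma Ann_xyz :
  [/\ Ann ('X_i * 'X_j * 'X_k : {mpoly K[n]}) = J, complete_intersection J &
      quotient_hilbert_function J (fun t => size (squarefree t))].
Proof.
have JE : [:: x ^+ 2; y ^+ 2; z ^+ 2] = map (@mon n K) squares by rewrite !mpsXn.
have -> : (fun t => size (squarefree t)) = (fun t => size (map (@mon n K) (squarefree t))).
  by apply/funext => t; rewrite size_map.
have pairingE (r : mpseries n K) : pairing ('X_i * 'X_j * 'X_k) r = r (U_(i) + U_(j) + U_(k))%MM.
  by rewrite -!mpolyXD pairingX.
apply: (@Ann_dual_generator n K _ _ (map (@mon n K) [:: U_(i); U_(j); U_(k)]%MM)
  (fun t => map (@mon n K) (squarefree t))
  (fun t => map (@mon n K) (squarefree (3 - t))) 4).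
- exact: power_regular_sequence.
- move=> h r; rewrite JE pairingE => /mapP[m ms ->]; rewrite mulrC mon_mulE.
  move: ms; rewrite (lepm_cover cover) !inE => /or3P[] /eqP ->;
  by rewrite !mnmS !neqs.
- exact: residue_variables.
- by [].
- move=> [|[|[|[|t]]]] h //=; rewrite !inE.
  + by case/or3P=> /eqP ->; exists 1; rewrite ?inE ?eqxx //;
      [exists x|exists y|exists z]; rewrite ?mul1r // !inE eqxx ?orbT.
  + case/or3P=> /eqP ->; rewrite monD.
    * by exists y; [|exists z]; rewrite // !inE eqxx ?orbT.
    * by exists x; [|exists z]; rewrite // !inE eqxx ?orbT.
    * by exists x; [|exists y]; rewrite // !inE eqxx ?orbT.
  + move=> ->; rewrite (monD K (U_(i) + U_(j))%MM).
    by exists (mon K (U_(i) + U_(j))%MM); [|exists z]; rewrite // !inE eqxx ?orbT.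
- move=> t h l /mapP[m ms ->] /mapP[m' ms' ->].
  rewrite JE -map_cat -monD; apply: mon_mem_span; rewrite has_cat.
  case: t ms => [|[|[|[|t]]]]; rewrite /squarefree /= ?nth_nil ?in_nil //;
    move: ms'; rewrite !inE !(lepm_cover cover).
  - by move=> /or3P[] /eqP -> /eqP ->; rewrite !mnmS !neqs.
  - by move=> /or3P[] /eqP -> /or3P[] /eqP ->; rewrite !mnmS !neqs.
  - by move=> /or3P[] /eqP -> /or3P[] /eqP ->; rewrite !mnmS !neqs.
  - by move=> /or3P[] /eqP -> /eqP ->; rewrite !mnmS !neqs.
- by [].
- move=> t l l'; rewrite !size_map /squarefree.
  case: t l l' => [|[|[|[|t]]]]; last by move=> l l'; rewrite /= nth_nil.
  + by move=> [|l] [|l'] //= _ _; rewrite -monD pairingE /= (eqm_cover cover) !mnmS !neqs.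
  + by move=> [|[|[|l]]] [|[|[|l']]] //= _ _; rewrite -monD pairingE /= (eqm_cover cover) !mnmS !neqs.
  + by move=> [|[|[|l]]] [|[|[|l']]] //= _ _; rewrite -monD pairingE /= (eqm_cover cover) !mnmS !neqs.
  + by move=> [|l] [|l'] //= _ _; rewrite -monD pairingE /= (eqm_cover cover) !mnmS !neqs.
- move=> t l h; rewrite size_map JE => lt /mapP[m ms ->].
  case: t l lt ms => [|[|[|t]]]; rewrite /squarefree ?nth_nil //=.
  + move=> [|l] //= _; rewrite !inE -monD => /or3P[] /eqP ->; apply: (@mon_mem_span squares);
    by rewrite /squares /= !(lepm_cover cover) !mnmS !neqs.
  + move=> [|[|[|l]]] //= _; rewrite !inE -monD => /or3P[] /eqP ->; apply: (@mon_mem_span squares);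
    by rewrite /squares /= !(lepm_cover cover) !mnmS !neqs.
  + move=> [|[|[|l]]] //= _; rewrite !inE -monD => /eqP ->; apply: (@mon_mem_span squares);
    by rewrite /squares /= !(lepm_cover cover) !mnmS !neqs.
  + by move=> l _; rewrite nth_nil.
Qed.


End SquareRelations.

(** * The ideal of a cusp singularity *)

(** Here s is the inverse of 1 - w, and the exponents are shifted by 2; the
    section is symmetric in the variables, so that each statement stands for
    all its permutations. *)
Section CuspRelations.

Variables (A : comNzRingType) (J : set A) (x y z s : A) (a b c : nat).
Hypothesis idJ : is_ideal J.
Hypothesis Jf : J (y * z - x ^+ a.+2).
Hypothesis Jg : J (x * z - y ^+ b.+2).
Hypothesis Jp : J (x * y - z ^+ c.+2).
Hypothesis sw : (1 - x ^+ a * y ^+ b * z ^+ c) * s = 1.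

(** Multiplying by 1 - w leaves an explicit combination of the generators,
    obtained by substituting in turn the relations for xy, yz and xz. *)
Lemma cusp_mixed2 : J (x * y ^+ 2).
Proof.
have [J0 JD JM] := idJ; rewrite -[_ * _]mul1r -sw.
rewrite (_ : _ * (x * _) = s * y * (x * y - z ^+ c.+2)
    + (s * z ^+ c.+1 * (y * z - x ^+ a.+2)
       + s * x ^+ a.+1 * z ^+ c * (x * z - y ^+ b.+2))); last by rewrite !exprS; ring.
by apply: (JD); [|apply: (JD)]; apply: JM.
Qed.

Lemma cusp_mixed p q : (0 < p)%N -> (1 < q)%N -> J (x ^+ p * y ^+ q).
Proof.
case: p q => [|p] [|[|q]] // _ _; have [J0 JD JM] := idJ.
rewrite (_ : _ * _ = x ^+ p * y ^+ q * (x * y ^+ 2)); last by rewrite !exprS; ring.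
exact/JM/cusp_mixed2.
Qed.

Lemma cusp_socle : J (x ^+ a.+3 - x * y * z).
Proof.
have [_ _ JM] := idJ; rewrite (_ : _ - _ = - x * (y * z - x ^+ a.+2)); first exact: JM.
by rewrite !exprS; ring.
Qed.

End CuspRelations.

(** The exponents of the statement are a + 3, b + 2 and c + 2 here.  Up to
    coefficients, F is the equation of a cusp singularity T_{a+4,b+3,c+3} and
    the generators of J are its partial derivatives. *)
Section CuspSingularity.

Variables (n : nat) (K : fieldType) (i j k : 'I_n) (a b c : nat).
Hypotheses (ij : i != j) (ik : i != k) (jk : j != k).
Hypothesis cover : forall l : 'I_n, l \in [:: i; j; k].
Hypotheses (cb : (c <= b)%N) (ba : (b <= a.+1)%N).

Local Notation R := (mpseries n K).
Local Notation x := (mpsX K i).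
Local Notation y := (mpsX K j).
Local Notation z := (mpsX K k).
Local Notation f := (y * z - x ^+ a.+3).
Local Notation g := (x * z - y ^+ b.+2).
Local Notation p := (x * y - z ^+ c.+2).
Local Notation J := (ideal_span [:: f; g; p]).

Let X : {mpoly K[n]} := 'X_i.
Let Y : {mpoly K[n]} := 'X_j.
Let Z : {mpoly K[n]} := 'X_k.
Let F := X ^+ a.+4 + Y ^+ b.+3 + Z ^+ c.+3 + X * Y * Z.

Lemma pairing_cusp r : pairing F r =
  r (U_(i) *+ a.+4)%MM + r (U_(j) *+ b.+3)%MM + r (U_(k) *+ c.+3)%MM
  + r (U_(i) + U_(j) + U_(k))%MM.
Proof. by rewrite /F /X /Y /Z !mpolyXn -!mpolyXD !pairingDl !pairingX. Qed.

Lemma cusp_unit : exists s, (1 - x ^+ a.+1 * y ^+ b * z ^+ c) * s = 1.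
Proof.
have [s sE] := @adic_unit n K i (x ^+ a * y ^+ b * z ^+ c).
by exists s; rewrite -[RHS]sE exprS !mulrA.
Qed.

Lemma cusp_is_ideal : is_ideal J. Proof. exact: is_ideal_span. Qed.
Lemma cusp_ideal_f : J f. Proof. by apply: ideal_span_mem; rewrite !inE eqxx. Qed.
Lemma cusp_ideal_g : J g. Proof. by apply: ideal_span_mem; rewrite !inE eqxx orbT. Qed.
Lemma cusp_ideal_p : J p. Proof. by apply: ideal_span_mem; rewrite !inE eqxx !orbT. Qed.

Definition variable_pairs := [:: (x, y); (y, x); (x, z); (z, x); (y, z); (z, y)].

Lemma variable_pairs_sym l l' :
  (l, l') \in variable_pairs -> (l', l) \in variable_pairs.
Proof.
move=> H; rewrite /variable_pairs !inE in H.
by case/or4P: H => [|||/or3P[]] /eqP[-> ->]; rewrite !inE eqxx ?orbT.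
Qed.

Lemma cusp_ideal_mixed q q' l l' : (0 < q)%N -> (1 < q')%N -> (l, l') \in variable_pairs ->
  J (l ^+ q * l' ^+ q').
Proof.
have [s sw] := cusp_unit; move=> q0 q1.
have Jf' : J (z * y - x ^+ a.+3) by rewrite [z * y]mulrC; apply: cusp_ideal_f.
have Jg' : J (z * x - y ^+ b.+2) by rewrite [z * x]mulrC; apply: cusp_ideal_g.
have Jp' : J (y * x - z ^+ c.+2) by rewrite [y * x]mulrC; apply: cusp_ideal_p.
have cm := fun x1 x2 x3 (a1 b1 c1 : nat) => @cusp_mixed R J x1 x2 x3 s a1 b1 c1 cusp_is_ideal.
rewrite !inE => /or4P[|||/or3P[]] /eqP[-> ->].
- by apply: (cm x y z a.+1 b c) => //;
    [exact: cusp_ideal_f|exact: cusp_ideal_g|exact: cusp_ideal_p].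
- by apply: (cm y x z b a.+1 c) => //;
    [apply: cusp_ideal_g|apply: cusp_ideal_f|rewrite -[RHS]sw; ring].
- by apply: (cm x z y a.+1 c b) => //;
    [apply: cusp_ideal_p|apply: cusp_ideal_g|rewrite -[RHS]sw; ring].
- by apply: (cm z x y c a.+1 b) => //; [apply: cusp_ideal_p|rewrite -[RHS]sw; ring].
- by apply: (cm y z x b c a.+1) => //; [apply: cusp_ideal_f|rewrite -[RHS]sw; ring].
- by apply: (cm z y x c b a.+1) => //; rewrite -[RHS]sw; ring.
Qed.

Lemma cusp_socle_x : J (x ^+ a.+4 - x * y * z).
Proof. exact: cusp_socle cusp_is_ideal cusp_ideal_f. Qed.

Lemma cusp_socle_y : J (y ^+ b.+3 - x * y * z).
Proof.
by rewrite (_ : x * y * z = y * x * z); [exact: cusp_socle cusp_is_ideal cusp_ideal_g|ring].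
Qed.

Lemma cusp_socle_z : J (z ^+ c.+3 - x * y * z).
Proof.
by rewrite (_ : x * y * z = z * x * y); [exact: cusp_socle cusp_is_ideal cusp_ideal_p|ring].
Qed.

Lemma cusp_top_x : J (x ^+ a.+4.+1).
Proof.
have [_ JD JM] := cusp_is_ideal.
rewrite (_ : x ^+ a.+4.+1 = x * (x ^+ a.+4 - x * y * z) + z * (y ^+ 1 * x ^+ 2)).
  by apply: JD; apply: JM; [exact: cusp_socle_x|];
    apply: cusp_ideal_mixed => //; rewrite !inE eqxx ?orbT.
by rewrite !exprS; ring.
Qed.

Lemma cusp_top_y : J (y ^+ b.+4).
Proof.
have [_ JD JM] := cusp_is_ideal.
rewrite (_ : y ^+ b.+4 = y * (y ^+ b.+3 - x * y * z) + z * (x ^+ 1 * y ^+ 2)).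
  by apply: JD; apply: JM; [exact: cusp_socle_y|];
    apply: cusp_ideal_mixed => //; rewrite !inE eqxx ?orbT.
by rewrite !exprS; ring.
Qed.

Lemma cusp_top_z : J (z ^+ c.+4).
Proof.
have [_ JD JM] := cusp_is_ideal.
rewrite (_ : z ^+ c.+4 = z * (z ^+ c.+3 - x * y * z) + y * (x ^+ 1 * z ^+ 2)).
  by apply: JD; apply: JM; [exact: cusp_socle_z|];
    apply: cusp_ideal_mixed => //; rewrite !inE eqxx ?orbT.
by rewrite !exprS; ring.
Qed.

(** The powers of x run up to the socle xyz = x^(a+4); those of y and z stop
    just before it, and start at t = 1 so that 1 is counted once. *)
Definition cusp_filt t : seq R :=
  nseq (t <= a.+4)%N (x ^+ t) ++ nseq (0 < t <= b.+2)%N (y ^+ t)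
  ++ nseq (0 < t <= c.+2)%N (z ^+ t).

Definition cusp_dual t : seq R :=
  [:: x ^+ (a.+4 - t); y ^+ (b.+3 - t); z ^+ (c.+3 - t)].

Lemma mem_cusp_filt t r : r \in cusp_filt t <->
  [\/ (t <= a.+4)%N /\ r = x ^+ t, (0 < t <= b.+2)%N /\ r = y ^+ t
    | (0 < t <= c.+2)%N /\ r = z ^+ t].
Proof.
rewrite /cusp_filt !mem_cat !mem_nseq !lt0b; split.
  by case/or3P=> /andP[? /eqP ?]; [constructor 1|constructor 2|constructor 3].
by case=> -[-> ->]; rewrite eqxx ?orbT.
Qed.

Lemma cusp_filt_prod t r : r \in cusp_filt t.+1 ->
  exists2 s, s \in cusp_filt t & exists2 l, l \in [:: x; y; z] & r = s * l.
Proof.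
move=> /mem_cusp_filt[] [tle ->]; [exists (x ^+ t)|exists (y ^+ t)|exists (z ^+ t)].
1: by apply/mem_cusp_filt; constructor 1; split=> //; lia.
1: by exists x; rewrite ?exprSr // !inE eqxx.
2: by exists y; rewrite ?exprSr // !inE eqxx orbT.
3: by exists z; rewrite ?exprSr // !inE eqxx !orbT.
all: case: t tle => [|t] tle; apply/mem_cusp_filt.
1, 3: by constructor 1; rewrite !expr0.
- by constructor 2; split=> //; lia.
- by constructor 3; split=> //; lia.
Qed.

(** Multiplication by a variable either raises a power, or produces a mixed
    product: yz, xz or xy when t = 1, which is a pure power of exponent at least
    2 modulo J, and an element of J when t > 1.  A power of y or z that leaves
    the list is congruent to x^(a+4). *)
Lemma cusp_filt_mulM t r l : r \in cusp_filt t -> l \in [:: x; y; z] ->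
  ideal_span ([:: f; g; p] ++ cusp_filt t.+1) (r * l).
Proof.
set S := ideal_span _; have [_ SD SM] : is_ideal S := is_ideal_span _.
have JS h : J h -> S h.
  apply: ideal_span_le => [|q qJ]; first exact: is_ideal_span.
  by apply: ideal_span_mem; rewrite mem_cat qJ.
have Vx h : (t.+1 <= a.+4)%N -> S (h * x ^+ t.+1).
  by move=> ta; apply: SM; apply: ideal_span_mem; rewrite mem_cat; apply/orP; right;
    apply/mem_cusp_filt; constructor 1.
have Vy h : (t.+1 <= b.+2)%N -> S (h * y ^+ t.+1).
  by move=> ta; apply: SM; apply: ideal_span_mem; rewrite mem_cat; apply/orP; right;
    apply/mem_cusp_filt; constructor 2.
have Vz h : (t.+1 <= c.+2)%N -> S (h * z ^+ t.+1).
  by move=> ta; apply: SM; apply: ideal_span_mem; rewrite mem_cat; apply/orP; right;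
    apply/mem_cusp_filt; constructor 3.
have SJ q q' : S q' -> J (q - q') -> S q.
  by move=> Sq' /JS Sqq'; rewrite -(subrK q' q); apply: SD.
have mix l1 l2 : (0 < t)%N -> (l1, l2) \in variable_pairs -> S (l1 ^+ t * l2).
  case: (t) Vx Vy Vz => [//|[|t']] Wx Wy Wz _ l12; last first.
    apply: JS; rewrite [l1 ^+ _ * _]mulrC -[l2]expr1; apply: cusp_ideal_mixed => //.
    exact: variable_pairs_sym.
  have Sxy : S (x * y) by apply: SJ cusp_ideal_p; rewrite -[c.+2]addn2 exprD; apply: Wz.
  have Sxz : S (x * z) by apply: SJ cusp_ideal_g; rewrite -[b.+2]addn2 exprD; apply: Wy.
  have Syz : S (y * z).
    by apply: SJ cusp_ideal_f; rewrite -[a.+3]addn2 exprD; apply: Wx.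
  rewrite expr1; move: l12; rewrite !inE => /or4P[|||/or3P[]] /eqP[-> ->] //;
    by rewrite mulrC.
have [t0 r1|t0] := posnP t.
  rewrite t0 in r1; have -> : r = 1 by case/mem_cusp_filt: r1 => -[] // _ ->; rewrite expr0.
  have := Vx 1; have := Vy 1; have := Vz 1; rewrite t0 !mul1r !expr1.
  by move=> Sz Sy Sx; rewrite !inE => /or3P[] /eqP ->; [apply: Sx|apply: Sy|apply: Sz].
have Jyx : J (y ^+ b.+3 - x ^+ a.+4).
  have -> : y ^+ b.+3 - x ^+ a.+4 = (y ^+ b.+3 - x * y * z) - (x ^+ a.+4 - x * y * z).
    by ring.
  exact: (idealB cusp_is_ideal cusp_socle_y cusp_socle_x).
have Jzx : J (z ^+ c.+3 - x ^+ a.+4).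
  have -> : z ^+ c.+3 - x ^+ a.+4 = (z ^+ c.+3 - x * y * z) - (x ^+ a.+4 - x * y * z).
    by ring.
  exact: (idealB cusp_is_ideal cusp_socle_z cusp_socle_x).
have Sx : (t.+1 <= a.+4)%N -> S (x ^+ a.+4).
  by move=> ta; rewrite -(subnK ta) exprD; apply: Vx.
case/mem_cusp_filt=> -[tle ->]; rewrite !inE => /or3P[] /eqP ->;
  try by apply: mix => //; rewrite !inE eqxx ?orbT.
- rewrite -exprSr; have [ta|ta] := ltnP t a.+4; first by rewrite -[_ ^+ _]mul1r; apply: Vx.
  by have -> : t = a.+4 by [lia]; apply: JS; exact: cusp_top_x.
- rewrite -exprSr; have [tb|tb] := ltnP t b.+2; first by rewrite -[_ ^+ _]mul1r; apply: Vy.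
  have tE : t = b.+2 by lia.
  by rewrite tE; apply: SJ Jyx; apply: Sx; rewrite tE; lia.
- rewrite -exprSr; have [tb|tb] := ltnP t c.+2; first by rewrite -[_ ^+ _]mul1r; apply: Vz.
  have tE : t = c.+2 by lia.
  by rewrite tE; apply: SJ Jzx; apply: Sx; rewrite tE; lia.
Qed.

Let mnmS := (@mnmDE n, @mnmBE n, @mulmnE n, @mnm1E n, @mnm0E n).
Let neqs := (negbTE ij, negbTE ik, negbTE jk,
  etrans (eq_sym j i) (negbTE ij), etrans (eq_sym k i) (negbTE ik),
  etrans (eq_sym k j) (negbTE jk), eqxx).

Lemma pairing_mon m : pairing F (mon K m) =
  (U_(i) *+ a.+4 == m)%MM%:R + (U_(j) *+ b.+3 == m)%MM%:R
  + (U_(k) *+ c.+3 == m)%MM%:R + (U_(i) + U_(j) + U_(k) == m)%MM%:R.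
Proof. exact: pairing_cusp. Qed.

Lemma pairing_pure : [/\ pairing F (x ^+ a.+4) = 1, pairing F (y ^+ b.+3) = 1
  & pairing F (z ^+ c.+3) = 1].
Proof.
by rewrite !mpsXn !pairing_mon !(eqm_cover cover) !mnmS !neqs !(mul1n, mul0n) /= ?eqxx ?addr0 ?add0r.
Qed.

(** No monomial of F involves exactly two variables. *)
Lemma pairing_mixed q q' l l' : (0 < q)%N -> (0 < q')%N ->
  (l, l') \in variable_pairs -> pairing F (l ^+ q * l' ^+ q') = 0.
Proof.
case: q q' => [|q] [|q'] // _ _ H; rewrite /variable_pairs !inE in H.
case/or4P: H => [|||/or3P[]] /eqP[-> ->];
  rewrite !mpsXn -monD pairing_mon !(eqm_cover cover) !mnmS !neqs;
  by rewrite !(mul1n, mul0n, muln1, add0n, addn0) /= ?andbF !addr0.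
Qed.

(** Both terms of yz - x^(a+3) pick the coefficient of x in r, the first one
    through XYZ and the second one through X^(a+4); likewise for the others. *)
Lemma pairing_cusp_ideal h r : h \in [:: f; g; p] -> pairing F (r * h) = 0.
Proof.
have ev m m' : (m == m') -> r m = r m' by move=> /eqP ->.
rewrite !inE => /or3P[] /eqP ->; rewrite mulrBr pairingB ![r * _]mulrC !mpsXn.
- rewrite -(@monD n K U_(j) U_(k)) !pairing_cusp !mon_mulE !(lepm_cover cover) !mnmS !neqs !(mul1n, mul0n) /=.
  rewrite !(addr0, add0r, leqnSn); apply/eqP; rewrite subr_eq0; apply/eqP/ev.
  by rewrite (eqm_cover cover) !mnmS !neqs !(mul1n, mul0n) /=; lia.
- rewrite -(@monD n K U_(i) U_(k)) !pairing_cusp !mon_mulE !(lepm_cover cover) !mnmS !neqs !(mul1n, mul0n) /=.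
  rewrite !(addr0, add0r, leqnSn); apply/eqP; rewrite subr_eq0; apply/eqP/ev.
  by rewrite (eqm_cover cover) !mnmS !neqs !(mul1n, mul0n) /=; lia.
- rewrite -(@monD n K U_(i) U_(j)) !pairing_cusp !mon_mulE !(lepm_cover cover) !mnmS !neqs !(mul1n, mul0n) /=.
  rewrite !(addr0, add0r, leqnSn); apply/eqP; rewrite subr_eq0; apply/eqP/ev.
  by rewrite (eqm_cover cover) !mnmS !neqs !(mul1n, mul0n) /=; lia.
Qed.

Lemma size_cusp_filt t : size (cusp_filt t) =
  ((t <= a.+4)%N + (0 < t <= b.+2)%N + (0 < t <= c.+2)%N)%N.
Proof. by rewrite /cusp_filt !size_cat !size_nseq addnA. Qed.

Lemma nth_cusp_filt t l : (l < size (cusp_filt t))%N ->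
  [\/ [/\ l = 0%N, (cusp_filt t)`_l = x ^+ t & (t <= a.+4)%N],
      [/\ l = 1%N, (cusp_filt t)`_l = y ^+ t & (0 < t <= b.+2)%N]
    | [/\ l = 2%N, (cusp_filt t)`_l = z ^+ t & (0 < t <= c.+2)%N]].
Proof.
rewrite size_cusp_filt /cusp_filt.
case: (leqP t a.+4) => ta; case: (boolP (0 < t <= b.+2)%N) => tb;
  case: (boolP (0 < t <= c.+2)%N) => tc; try lia;
  case: l => [|[|[|l]]] //= _; by [constructor 1|constructor 2|constructor 3].
Qed.

Lemma cusp_dual_pairing t l l' : (l < size (cusp_filt t))%N ->
    (l' < size (cusp_filt t))%N ->
  pairing F ((cusp_dual t)`_l * (cusp_filt t)`_l') = (l == l')%:R.
Proof.
have [px py pz] := pairing_pure.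
by case/nth_cusp_filt=> -[-> _ tl]; case/nth_cusp_filt=> -[-> -> tl'] /=;
  (rewrite -exprD subnK; [done|lia]) ||
  (apply: pairing_mixed; [lia|lia|by rewrite !inE eqxx ?orbT]).
Qed.

(** Every product is either x^(a+5), y^(b+4) or z^(c+4), or mixed with one
    exponent at least 2. *)
Lemma cusp_dual_orth t l r : (l < size (cusp_filt t))%N -> r \in cusp_filt t.+1 ->
  J ((cusp_dual t)`_l * r).
Proof.
have [_ _ JM] := cusp_is_ideal.
have [tx ty tz] : [/\ J (x ^+ a.+4.+1), J (y ^+ b.+4) & J (z ^+ c.+4)].
  by split; [exact: cusp_top_x|exact: cusp_top_y|exact: cusp_top_z].
case/nth_cusp_filt=> -[-> _ tl]; case/mem_cusp_filt=> -[tl' ->] /=.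
all: try by rewrite -exprD addnS subnK; [|lia].
all: try by apply: cusp_ideal_mixed; [lia|lia|rewrite !inE eqxx ?orbT].
all: by rewrite [_ ^+ _ * _]mulrC; apply: cusp_ideal_mixed; [lia|lia|rewrite !inE eqxx ?orbT].
Qed.

Theorem Ann_cusp :
  [/\ Ann F = J, complete_intersection J &
      quotient_hilbert_function J (fun t => size (cusp_filt t))].
Proof.
apply: (@Ann_dual_generator n K F [:: f; g; p] [:: x; y; z] cusp_filt cusp_dual a.+4.+1).
- exact: cusp_regular_sequence.
- by move=> h r; apply: pairing_cusp_ideal.
- exact: residue_variables.
- by rewrite /cusp_filt /= expr0.
- exact: cusp_filt_prod.
- exact: cusp_filt_mulM.
- by apply/nilP; rewrite /nilp size_cusp_filt; lia.
- exact: cusp_dual_pairing.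
- exact: cusp_dual_orth.
Qed.

End CuspSingularity.

(** * The Hilbert function *)

Lemma hvec_hseq_cusp (K : fieldType) n (i j k : 'I_n) (u v w a : nat) :
  (u + v + w = a.+1)%N ->
  hvec (hseq u v w) = fun t => size (cusp_filt K i j k a (u + v) u t).
Proof.
move=> ea; apply/funext => t; rewrite size_cusp_filt /hvec /hseq.
case: t => [|[|[|t]]] //=; rewrite ?nth_cat ?size_nseq ?nth_nseq.
case: ltnP => tu; first by lia.
case: ltnP => tv; first by lia.
case: ltnP => tw; first by lia.
by case qE: (t - u - v - w)%N => [|q] /=; rewrite ?nth_nil; lia.
Qed.

Theorem theorem4p1 (K : fieldType) (u v w : nat)
    (hO : O_sequence (hvec (hseq u v w))) :
  let R := mpseries 3 K in
  let x : R := mpsX K (@Ordinal 3 0 isT) in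
  let y : R := mpsX K (@Ordinal 3 1 isT) in
  let z : R := mpsX K (@Ordinal 3 2 isT) in
  let X : {mpoly K[3]} := 'X_(@Ordinal 3 0 isT) in
  let Y : {mpoly K[3]} := 'X_(@Ordinal 3 1 isT) in
  let Z : {mpoly K[3]} := 'X_(@Ordinal 3 2 isT) in
  [/\ exists f g p : R,
        complete_intersection (ideal_span [:: f; g; p]) /\
        quotient_hilbert_function (ideal_span [:: f; g; p])
          (hvec (hseq u v w)),
      [/\ u = 0%N, v = 0%N & w = 0%N] ->
        [/\ Ann (X * Y * Z) = ideal_span [:: x ^+ 2; y ^+ 2; z ^+ 2],
            complete_intersection (Ann (X * Y * Z)),
            hseq u v w = [:: 1; 3; 3; 1]%N &
            quotient_hilbert_function (Ann (X * Y * Z))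
              (hvec (hseq u v w))]
    & [\/ u != 0%N, v != 0%N | w != 0%N] ->
        let F := X ^+ (u + v + w + 3) + Y ^+ (u + v + 3) + Z ^+ (u + 3)
                 + X * Y * Z in
        [/\ Ann F = ideal_span [:: y * z - x ^+ (u + v + w + 2);
                                   x * z - y ^+ (u + v + 2);
                                   x * y - z ^+ (u + 2)],
            complete_intersection (Ann F) &
            quotient_hilbert_function (Ann F)
              (hvec (hseq u v w))]].
Proof.
set i0 := Ordinal _; set i1 := Ordinal _; set i2 := Ordinal _.
have cover (l : 'I_3) : l \in [:: i0; i1; i2].
  by case: l => [[|[|[|//]]] ?]; rewrite !inE -!val_eqE.
move=> R x y z X Y Z.
have case1 : [/\ u = 0%N, v = 0%N & w = 0%N] ->
    [/\ Ann (X * Y * Z) = ideal_span [:: x ^+ 2; y ^+ 2; z ^+ 2],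
        complete_intersection (Ann (X * Y * Z)),
        hseq u v w = [:: 1; 3; 3; 1]%N &
        quotient_hilbert_function (Ann (X * Y * Z)) (hvec (hseq u v w))].
  case=> -> -> ->.
  have [AE ci hf] := @Ann_xyz 3 K i0 i1 i2 isT isT isT cover.
  split=> //; rewrite AE //.
  rewrite (_ : hvec _ = fun t => size (squarefree i0 i1 i2 t)) //.
  by apply/funext => -[|[|[|[|t]]]] //; rewrite /hvec /squarefree /= !nth_nil.
have case2 : [\/ u != 0%N, v != 0%N | w != 0%N] ->
    let F := X ^+ (u + v + w + 3) + Y ^+ (u + v + 3) + Z ^+ (u + 3) + X * Y * Z in
    [/\ Ann F = ideal_span [:: y * z - x ^+ (u + v + w + 2);
                               x * z - y ^+ (u + v + 2);
                               x * y - z ^+ (u + 2)],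
        complete_intersection (Ann F) &
        quotient_hilbert_function (Ann F) (hvec (hseq u v w))].
  move=> uvw F; have [a ea] : exists a, (u + v + w = a.+1)%N.
    by exists (u + v + w).-1; case: uvw; lia.
  have [AE ci hf] := @Ann_cusp 3 K i0 i1 i2 a (u + v) u isT isT isT cover
    (leq_addr _ _) (leq_trans (leq_addr w _) (eq_leq ea)).
  have FE : F = X ^+ a.+4 + Y ^+ (u + v).+3 + Z ^+ u.+3 + X * Y * Z.
    by rewrite /F ea !addn3.
  by rewrite FE AE ea !addn2 (hvec_hseq_cusp K i0 i1 i2 ea).
split=> //.
have [uvw|] := boolP [&& u == 0%N, v == 0%N & w == 0%N].
  have /and3P[/eqP u0 /eqP v0 /eqP w0] := uvw.
  have [AE ci _ hf] := case1 (And3 u0 v0 w0).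
  by exists (x ^+ 2), (y ^+ 2), (z ^+ 2); rewrite -AE.
rewrite !negb_and => /or3P uvw.
have [AE ci hf] := case2 uvw.
exists (y * z - x ^+ (u + v + w + 2)), (x * z - y ^+ (u + v + 2)),
  (x * y - z ^+ (u + 2)).
by rewrite -AE.
Qed.
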